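(* For all natural numbers $i<k$ there exists an unambiguous regular language $L$ of infinite trees (i.e. $L$ is recognised by some nondeterministic parity tree automaton that has at most one accepting run on every tree) such that $L$ cannot be recognised by any alternating parity tree automaton whose priorities all lie in $\{i,i+1,\ldots,k\}$. In other words, unambiguous tree languages do not lie in any fixed level $(i,k)$ of the parity (Rabin–Mostowski) index hierarchy of alternating automata.
   Context: Trees are over finite ranked alphabets: a tree over $A$ is a partial map $t:\omega^*\to A$ with non-empty prefix-closed domain such that a node labelled by an $m$-ary letter has exactly the children $u0,\ldots,u(m-1)$. A nondeterministic parity tree automaton has finitely many states, transitions $(q,a,q_0,\ldots,q_{m-1})$ for $m$-ary letters $a$, a set of initial states and a priority map; a run assigns states to nodes, starts in an initial state, respects transitions, and is accepting if on every branch the least priority occurring infinitely often is even. Alternating parity tree automata and the levels $(i,k)$ of the index hierarchy (languages recognised by alternating parity tree automata using priorities in $\{i,\ldots,k\}$) are the standard notions. *)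

(* Defs.v *)
From mathcomp Require Import all_boot.
Set Implicit Arguments.
Unset Strict Implicit.
Unset Printing Implicit Defensive.

Section Trees.
Variables (A : finType) (ar : A -> nat).

Definition is_tree (t : seq nat -> option A) : Prop :=
  [/\ exists u, t u <> None,
      forall u v, t (u ++ v) <> None -> t u <> None
    & forall u a, t u = Some a -> forall d, t (rcons u d) <> None <-> d < ar a].

Definition is_branch (t : seq nat -> option A) (beta : nat -> nat) : Prop :=
  forall n, t (mkseq beta n) <> None.

End Trees.

Definition inf_often (P : nat -> Prop) : Prop :=
  forall n, exists m, n <= m /\ P m.

Definition parity_win (s : nat -> option nat) : Prop :=
  exists p, ~~ odd p /\ inf_often (fun n => s n = Some p)
            /\ forall p', p' < p -> ~ inf_often (fun n => s n = Some p').

Record NPTA (A : finType) (ar : A -> nat) := {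
  nQ : finType;
  ninit : pred nQ;
  ntrans : nQ -> forall a : A, pred {ffun 'I_(ar a) -> nQ};
  nprio : nQ -> nat }.
Arguments NPTA : clear implicits.
Arguments nQ {A ar} n.
Arguments ninit {A ar} n _.
Arguments ntrans {A ar} n _ a _.
Arguments nprio {A ar} n _.

Section NPTAsem.
Variables (A : finType) (ar : A -> nat) (N : NPTA A ar).

Definition nrun (t : seq nat -> option A) (rho : seq nat -> nQ N) : Prop :=
  ninit N (rho [::]) /\
  forall u a, t u = Some a ->
    ntrans N (rho u) a [ffun d : 'I_(ar a) => rho (rcons u (val d))].

Definition naccepting_run (t : seq nat -> option A) (rho : seq nat -> nQ N)
  : Prop :=
  nrun t rho /\
  forall beta, is_branch t beta ->
    parity_win (fun n => Some (nprio N (rho (mkseq beta n)))).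

Definition naccepts (t : seq nat -> option A) : Prop :=
  exists rho, naccepting_run t rho.

Definition unambiguous : Prop :=
  forall t, is_tree ar t -> forall rho1 rho2,
    naccepting_run t rho1 -> naccepting_run t rho2 ->
    forall u, t u <> None -> rho1 u = rho2 u.

End NPTAsem.

Inductive pbf (D Q : Type) : Type :=
  | PTrue | PFalse
  | PAtom of D & Q
  | PAnd of pbf D Q & pbf D Q
  | POr of pbf D Q & pbf D Q.
Arguments PTrue {D Q}.
Arguments PFalse {D Q}.

Fixpoint pbf_map (D D' Q : Type) (f : D -> D') (phi : pbf D Q) : pbf D' Q :=
  match phi with
  | PTrue => PTrue
  | PFalse => PFalse
  | PAtom d q => PAtom (f d) q
  | PAnd p1 p2 => PAnd (pbf_map f p1) (pbf_map f p2)
  | POr p1 p2 => POr (pbf_map f p1) (pbf_map f p2)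
  end.

Record APTA (A : finType) (ar : A -> nat) := {
  aQ : finType;
  ainit : aQ;
  atrans : aQ -> forall a : A, pbf 'I_(ar a) aQ;
  aprio : aQ -> nat }.
Arguments APTA : clear implicits.
Arguments aQ {A ar} a0.
Arguments ainit {A ar} a0.
Arguments atrans {A ar} a0 _ a.
Arguments aprio {A ar} a0 _.

Section APTAsem.
Variables (A : finType) (ar : A -> nat) (B : APTA A ar).
Variable t : seq nat -> option A.

Definition delta_at (q : aQ B) (u : seq nat) : pbf nat (aQ B) :=
  match t u with
  | Some a => pbf_map (@nat_of_ord (ar a)) (atrans B q a)
  | None => PFalse
  end.

Definition gpos := (seq nat * pbf nat (aQ B))%type.

(* A strategy sees the history (most recent position first) and chooses
   the left (true) or right (false) subformula. Eve resolves disjunctions,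
   Adam conjunctions. *)
Definition strategy := seq gpos -> bool.

Definition gstep (sE sA : strategy) (h : seq gpos) (cur : gpos) : gpos :=
  let: (u, phi) := cur in
  match phi with
  | PAnd f1 f2 => if sA (cur :: h) then (u, f1) else (u, f2)
  | POr f1 f2 => if sE (cur :: h) then (u, f1) else (u, f2)
  | PAtom d q => (rcons u d, delta_at q (rcons u d))
  | PTrue => cur
  | PFalse => cur
  end.

Fixpoint play_hist (sE sA : strategy) (n : nat) : seq gpos :=
  match n with
  | 0 => [:: ([::], delta_at (ainit B) [::])]
  | n'.+1 =>
      let h := play_hist sE sA n' in
      match h with
      | cur :: past => gstep sE sA past cur :: h
      | [::] => [::]
      end
  end.

Definition play (sE sA : strategy) (n : nat) : gpos :=
  head ([::], PFalse) (play_hist sE sA n).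

Definition gprio (p : gpos) : option nat :=
  match p.2 with
  | PAtom _ q => Some (aprio B q)
  | _ => None
  end.

Definition eve_wins_play (pl : nat -> gpos) : Prop :=
  (exists n, (pl n).2 = PTrue) \/ parity_win (fun n => gprio (pl n)).

Definition aaccepts : Prop :=
  exists sE : strategy, forall sA : strategy, eve_wins_play (play sE sA).

End APTAsem.

(* Main.v *)
Require Import Defs.
From mathcomp Require Import all_boot boolp.

(** Trees encode parity games: children 0 and 1 of a node are the two moves, and
    child 2 is an auxiliary game.  The automaton guesses a winner only where it
    is needed: under the claim "player R wins", the winner guessed for child 2
    tells which move R makes, so ambiguity would need one auxiliary game claimed
    for both players; the two runs would then share an infinite branch whose
    parities exclude each other.

    For hardness, child 2 of a position of player R is the game in which R claims
    that the signature (least progress measure, a lexicographically ordered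
    vector of ordinals) of the first move is at most that of the second.  This
    comparison game advances one of the two compared games at a time: the first
    one while the claim is [<=], the second one, with the roles exchanged, while
    it is [<].  While a claim [<] about the components up to [m] stands, the
    priorities of the second game exceed [m], so shifting them down by one
    dualises it inside the same range of priorities; hence comparisons can be
    nested forever over one finite alphabet.  A player winning a position
    therefore wins by following the comparison games, which are themselves won
    by one of the players.

    If an alternating automaton B recognised the language, its acceptance game
    with the players exchanged would be encoded, by a fixed point, in the very
    tree it reads, and that tree would be accepted exactly when B rejects it. *)

Set Implicit Arguments.
Unset Strict Implicit.
Unset Printing Implicit Defensive.

(** * Ordinals and lexicographic orders *)

Section Ordinals.
Variable I : Type.

(** [OS f] stands for the least ordinal above all [f x]. Indexing by [option I] keeps the family
    nonempty and lets every [I]-indexed family be strictly bounded. Ordinals are compared only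
    through the preorder [ole]. *)
Inductive ord := OZ | OS of (option I -> ord).

Fixpoint ole (a b : ord) {struct a} : Prop :=
  match a, b with
  | OZ, _ => True
  | OS _, OZ => False
  | OS f, OS g => forall x, exists y, ole (f x) (g y)
  end.

Definition olt a b := ~ ole b a.

Lemma ole_refl a : ole a a.
Proof. by elim: a => //= f IH x; exists x. Qed.

Lemma ole_trans a b c : ole a b -> ole b c -> ole a c.
Proof.
elim: a b c => //= f IH [|g] // [|h] //= ab bc x.
have [y fy] := ab x; have [z gz] := bc y.
by exists z; apply: IH fy gz.
Qed.

(** The strict case comes with an explicit predecessor of [a]; totality and well-foundedness both
    rest on it. *)
Lemma ole_or_lt a b : ole a b \/ exists f x, a = OS f /\ ole b (f x).
Proof.
elim: a b => [|f IH] [|g]; [by left|by left|by right; exists f, None|].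
have [h|/existsNP[x /forallNP nx]] :=
  pselect (forall x, exists y, ole (f x) (g y)); first by left.
right; exists f, x; split=> //.
case: (IH x (g None)) => [/nx //|[f' [x' [fx _]]]].
rewrite fx /= => y.
case: (IH x (g y)) => [/nx //|[f2 [x2 [fx2 le2]]]].
by exists x2; move: fx2; rewrite fx => -[->].
Qed.

Lemma ole_OS f x : ole (f x) (OS f).
Proof.
move: {-1}(f x) (erefl (f x)) => a; elim: a f x => // g IH f x fx /= y.
by exists x; rewrite fx; apply: IH.
Qed.

Lemma ole_total a b : ole a b \/ ole b a.
Proof.
case: (ole_or_lt a b) => [|[f [x [-> le]]]]; [by left|right].
exact: ole_trans le (ole_OS f x).
Qed.

Lemma olt_wf : well_founded olt.
Proof.
suff h a : forall b, ole b a -> Acc olt b by move=> a; apply: h (ole_refl a).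
elim: a => [|g IH] b ba; constructor=> c cb.
  case: (ole_or_lt b c) => [/cb //|[f [x [bf _]]]].
  by move: ba; rewrite bf.
case: (ole_or_lt b c) => [/cb //|[f [x [bf cf]]]].
move: ba; rewrite bf /= => /(_ x)[y fy].
exact: IH (ole_trans cf fy).
Qed.

Lemma olt_OS f x : olt (f x) (OS f).
Proof.
move=> le; move: {-1}(f x) (erefl (f x)) le => a.
elim: a f x => // g IH f x fx /= /(_ x)[y]; rewrite fx.
exact: IH.
Qed.

Lemma ord_bound (f : I -> ord) : exists o, forall x, olt (f x) o.
Proof.
exists (OS (fun i => if i is Some x then f x else OZ)) => x.
exact: (@olt_OS (fun i => if i is Some x then f x else OZ) (Some x)).
Qed.

Lemma ole_lt_trans a b c : ole a b -> olt b c -> olt a c.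
Proof. by move=> ab bc ca; apply: bc; apply: ole_trans ca ab. Qed.

Lemma olt_le_trans a b c : olt a b -> ole b c -> olt a c.
Proof. by move=> ab bc ca; apply: ab; apply: ole_trans bc ca. Qed.

Definition vec := nat -> ord.

(** Components [0] to [q] inclusive count. As [ole] is only a preorder, a tie on the earlier ones
    reads [lex q' g f]. *)
Fixpoint lex (q : nat) (f g : vec) : Prop :=
  if q is q'.+1 then lex q' f g /\ (lex q' g f -> ole (f q) (g q))
  else ole (f 0) (g 0).

Definition lexlt q (f g : vec) := ~ lex q g f.

Lemma lex_refl q f : lex q f f.
Proof. by elim: q => [|q IH] /=; [|split=> // _]; exact: ole_refl. Qed.

Lemma lex_trans q f g h : lex q f g -> lex q g h -> lex q f h.
Proof.
elim: q f g h => [|q IH] f g h /=; first exact: ole_trans.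
move=> [fg fg'] [gh gh']; split; first exact: IH gh.
move=> hf; apply: (@ole_trans _ (g q.+1)).
  by apply: fg'; apply: IH hf.
by apply: gh'; apply: IH fg.
Qed.

Lemma lex_total q f g : lex q f g \/ lex q g f.
Proof.
elim: q => [|q IH] /=; first exact: ole_total.
have [fg|nfg] := pselect (lex q f g); have [gf|ngf] := pselect (lex q g f).
- by case: (ole_total (f q.+1) (g q.+1)) => le; [left|right].
- by left.
- by right.
- by case: IH.
Qed.

Lemma lexltW q f g : lexlt q f g -> lex q f g.
Proof. by move=> lt; case: (lex_total q f g) => // /lt. Qed.

Lemma lex_lt_trans q f g h : lex q f g -> lexlt q g h -> lexlt q f h.
Proof. by move=> fg gh hf; apply: gh; apply: lex_trans hf fg. Qed.

Lemma lexlt_le_trans q f g h : lexlt q f g -> lex q g h -> lexlt q f h.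
Proof. by move=> fg gh hf; apply: fg; apply: lex_trans gh hf. Qed.

Lemma lex_mono p q f g : p <= q -> lex q f g -> lex p f g.
Proof.
elim: q => [|q IH]; first by rewrite leqn0 => /eqP->.
by rewrite leq_eqVlt => /orP[/eqP-> //|le] [/(IH le)].
Qed.

Lemma lexlt_mono p q f g : p <= q -> lexlt p f g -> lexlt q f g.
Proof. by move=> pq lt /(lex_mono pq). Qed.

Lemma lexlt_wf q : well_founded (lexlt q).
Proof.
elim: q => [|q IHq].
  move=> f; move: {-1}(f 0) (ole_refl (f 0)) => o.
  elim/(well_founded_ind olt_wf): o f => o IH f le; constructor=> g gf.
  by apply: (IH (g 0)); [exact: olt_le_trans gf le|exact: ole_refl].
(* Nested induction: on a bound [F] for the components up to [q], then on a bound [o] for component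
   [q.+1]. *)
suff h F : forall f, lex q f F -> Acc (lexlt q.+1) f.
  by move=> f; apply: h (lex_refl q f).
elim/(well_founded_ind IHq): F => F IHF f fF.
move: {-1}(f q.+1) (ole_refl (f q.+1)) => o.
elim/(well_founded_ind olt_wf): o f fF => o IHo f fF fo.
constructor=> g gf.
have [fg|nfg] := pselect (lex q f g); last first.
  by apply: (IHF g); [exact: lexlt_le_trans nfg fF|exact: lex_refl].
have [gf'|ngf] := pselect (lex q g f); last first.
  by case: (lexltW gf) => /ngf.
apply: (IHo (g q.+1)); [|exact: lex_trans gf' fF|exact: ole_refl].
by apply: olt_le_trans fo => le; apply: gf; split=> // _.
Qed.

Lemma lex_congr q (f g f' g' : vec) :
  (forall j, j <= q -> (f j = f' j /\ g j = g' j) \/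
     [/\ ole (f j) (g j), ole (g j) (f j), ole (f' j) (g' j)
       & ole (g' j) (f' j)]) ->
  lex q f g <-> lex q f' g'.
Proof.
elim: q f g f' g' => [|q IH] f g f' g' h /=.
  by case: (h 0 isT) => [[-> ->]|[? ? ? ?]].
have h1 j : j <= q -> _ := fun le => h j (leqW le).
have h2 : lex q f g <-> lex q f' g' by apply: IH.
have h3 : lex q g f <-> lex q g' f'.
  by apply: IH => j /h1 [[-> ->]|[? ? ? ?]]; [left|right].
rewrite h2 h3; case: (h q.+1 (leqnn _)) => [[-> ->] //|[? ? ? ?]].
by split=> -[? _].
Qed.

(** Player [true] wants the least recurring priority to be even, player [false] wants it odd. *)
Definition bad (e : bool) (p : nat) := odd p == e.

(** The progress-measure condition of player [e] for a move out of priority [p], from value [f] to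
    [f']. Quantifying over [q < p] avoids the index [p - 1], so that a good priority [0] imposes
    nothing. *)
Definition cond (e : bool) (p : nat) (f' f : vec) : Prop :=
  if bad e p then lexlt p f' f else forall q, q < p -> lex q f' f.

Lemma cond_lex e p f' f q : cond e p f' f -> q < p -> lex q f' f.
Proof.
rewrite /cond; case: ifP => _ h lt; last exact: h.
exact: lex_mono (ltnW lt) (lexltW h).
Qed.

Lemma cond_le e p f' f g' g :
  lex p g' f' -> lex p f g -> cond e p f' f -> cond e p g' g.
Proof.
rewrite /cond => h1 h2; case: ifP => _ h.
  exact: lexlt_le_trans (lex_lt_trans h1 h) h2.
move=> q lt; apply: lex_trans (lex_mono (ltnW lt) h2).
by apply: lex_trans (h _ lt); apply: lex_mono (ltnW lt) h1.
Qed.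

End Ordinals.

Arguments OZ {I}.

(** * Progress along infinite plays *)

Definition min_inf (a : nat -> nat) (q : nat) : Prop :=
  inf_often (fun n => a n = q) /\
  forall p, p < q -> ~ inf_often (fun n => a n = p).

Lemma eventually_ge (a : nat -> nat) q :
  (forall p, p < q -> ~ inf_often (fun n => a n = p)) ->
  exists M, forall n, M <= n -> q <= a n.
Proof.
elim: q => [|q IH] h; first by exists 0.
have [p lt|M hM] := IH; first by apply: h; apply: leqW.
have /existsNP[M' /forallNP hM'] := h q (leqnn _).
exists (maxn M M') => n; rewrite geq_max => /andP[le le'].
rewrite ltn_neqAle hM // andbT; apply/eqP => E.
by apply: (hM' n); split.
Qed.

Lemma min_inf_exists (a : nat -> nat) K N :
  (forall n, N <= n -> a n <= K) ->
  exists q, min_inf a q.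
Proof.
move=> bnd.
have ex : exists q, `[<inf_often (fun n => a n = q)>].
  apply: contrapT => /forallNP h.
  have [p _|M hM] := @eventually_ge a K.+1.
    by move=> hp; apply: (h p); apply/asboolP.
  have := hM _ (leq_maxl M N); rewrite ltnNge => /negP; apply.
  exact: bnd (leq_maxr M N).
case: (ex_minnP ex) => q /asboolP hq min; exists q; split=> // p lt hp.
by have := min p (asboolT hp); rewrite leqNgt lt.
Qed.

(** If [q] were bad, then once smaller priorities have ceased, the components up to [q] would never
    grow and would drop at each visit to [q], against well-foundedness. *)
Lemma cond_sound I e (a : nat -> nat) (F : nat -> vec I) N q :
  (forall n, N <= n -> cond e (a n) (F n.+1) (F n)) ->
  inf_often (fun n => a n = q) ->
  (forall p, p < q -> ~ inf_often (fun n => a n = p)) -> ~~ bad e q.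
Proof.
move=> hc inf /eventually_ge[M hM]; apply/negP => bq.
pose L := maxn M N.
have dec n : L <= n -> lex q (F n.+1) (F n).
  rewrite geq_max => /andP[Mn Nn].
  have := hM _ Mn; rewrite leq_eqVlt => /orP[/eqP E|lt].
    by have := hc _ Nn; rewrite /cond -E bq => /lexltW.
  exact: cond_lex (hc _ Nn) lt.
have decs m n : L <= n -> n <= m -> lex q (F m) (F n).
  move=> Ln; elim: m => [|m IH].
    by rewrite leqn0 => /eqP->; apply: lex_refl.
  rewrite leq_eqVlt => /orP[/eqP->|le]; first exact: lex_refl.
  by apply: lex_trans (IH le); apply: dec; apply: leq_trans Ln le.
suff h f n : L <= n -> lex q (F n) f -> False.
  exact: (h _ L (leqnn _) (lex_refl _ _)).
elim/(well_founded_ind (@lexlt_wf I q)): f n => f IH n Ln Fn.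
have [m [le am]] := inf n.
have Lm := leq_trans Ln le.
apply: (IH (F m.+1) _ m.+1 _ (lex_refl _ _)); last exact: leqW.
have := hc m (leq_trans (leq_maxr _ _) Lm); rewrite /cond am bq => lt.
exact: lexlt_le_trans lt (lex_trans (decs _ _ Ln le) Fn).
Qed.

Lemma cond_conflict I J e (a : nat -> nat) (F : nat -> vec I)
    (G : nat -> vec J) N K :
  (forall n, N <= n -> a n <= K) ->
  (forall n, N <= n -> cond e (a n) (F n.+1) (F n)) ->
  (forall n, N <= n -> cond (~~ e) (a n) (G n.+1) (G n)) -> False.
Proof.
move=> /min_inf_exists[q [inf min]] hF hG.
have := cond_sound hF inf min; have := cond_sound hG inf min.
by rewrite /bad; case: (odd q) (e) => [] [].
Qed.

(** Lowering positive priorities by one flips their parity, so one player cannot have progress for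
    both readings of the same play. *)
Lemma cond_conflict_pred I J e (a : nat -> nat) (F : nat -> vec I)
    (G : nat -> vec J) N K :
  (forall n, N <= n -> 0 < a n <= K) ->
  (forall n, N <= n -> cond e (a n) (F n.+1) (F n)) ->
  (forall n, N <= n -> cond e (a n).-1 (G n.+1) (G n)) -> False.
Proof.
move=> bnd hF hG.
have [|q [inf min]] := @min_inf_exists a K N.
  by move=> n /bnd /andP[].
have infN m : exists n, [/\ N <= n, m <= n & a n = q].
  have [n [le an]] := inf (maxn m N).
  by exists n; split=> //; apply: leq_trans le; rewrite ?leq_maxl ?leq_maxr.
have q0 : 0 < q.
  by have [n [/bnd /andP[lt _] _ <-]] := infN 0.
have := cond_sound hF inf min.
have h : ~~ bad e q.-1.
  apply: (cond_sound hG) => [m|p lt hp].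
    by have [n [_ le <-]] := infN m; exists n.
  apply: (min p.+1); first by rewrite -ltn_predRL.
  move=> m; have [n [le an]] := hp (maxn m N).
  move: le; rewrite geq_max => /andP[le Nn].
  exists n; split=> //.
  by rewrite -an prednK //; case/andP: (bnd _ Nn).
by move: h; rewrite /bad -(prednK q0) /=; case: (odd _) (e) => [] [].
Qed.

Lemma step_sequence (T : Type) (Q : T -> Prop) (R : T -> T -> Prop) x0 :
  (forall x, Q x -> exists y, Q y /\ R x y) -> Q x0 ->
  exists s : nat -> T, s 0 = x0 /\ forall n, Q (s n) /\ R (s n) (s n.+1).
Proof.
move=> h Q0.
have /choice[g hg] : forall x, exists y, Q x -> Q y /\ R x y.
  move=> x; have [/h[y hy]|nQ] := pselect (Q x); first by exists y.
  by exists x.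
exists (fun n => iter n g x0); split=> // n.
have Qn : Q (iter n g x0) by elim: n => //= n /hg[].
by split=> //; have [] := hg _ Qn.
Qed.

(** * Positional determinacy by progress measures *)

Definition force (c : bool) (Q : bool -> Prop) : Prop :=
  if c then exists d, Q d else forall d, Q d.

Lemma force_mono c (Q Q' : bool -> Prop) :
  (forall d, Q d -> Q' d) -> force c Q -> force c Q'.
Proof.
by case: c => h /= hQ; [have [d /h] := hQ; exists d|move=> d; exact/h/hQ].
Qed.

Lemma force_meet c (Q Q' : bool -> Prop) :
  force c Q -> force (~~ c) Q' -> exists d, Q d /\ Q' d.
Proof. by case: c => /= [[d h] h'|h [d h']]; exists d. Qed.

Lemma forceN c (Q : bool -> Prop) :
  ~ force c Q -> force (~~ c) (fun d => ~ Q d).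
Proof. by case: c => /= [/forallNP|/existsNP]. Qed.

Section Games.
Variables (X : Type) (own : X -> bool) (succ : X -> bool -> X).
Variables (pr : X -> nat) (K : nat).
Hypothesis prK : forall x, pr x <= K.

Notation V := (vec X).

(** [S] is a region won by [e], witnessed by [rho]. A value [Some c] of [st] ends the play there
    with winner [c]. *)
Definition meas (st : X -> option bool) (e : bool) (S : X -> Prop)
    (rho : X -> V) : Prop :=
  forall x, S x -> st x <> Some (~~ e) /\
    (st x = None -> force (own x == e) (fun d => S (succ x d) /\
       cond e (pr x) (rho (succ x d)) (rho x))).

(** Playing the two measures against each other gives an infinite play on which both players
    progress. *)
Lemma meas_conflict st1 st2 e S1 r1 S2 r2 x :
  meas st1 e S1 r1 -> meas st2 (~~ e) S2 r2 ->
  (forall x, S1 x -> S2 x -> st1 x = None /\ st2 x = None) ->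
  S1 x -> S2 x -> False.
Proof.
move=> m1 m2 hst S1x S2x.
have [|//|s [_ hs]] := @step_sequence X (fun x => S1 x /\ S2 x)
  (fun x y => cond e (pr x) (r1 y) (r1 x) /\ cond (~~ e) (pr x) (r2 y) (r2 x)) x.
  move=> {S1x S2x}x [S1x S2x].
  have [st1x st2x] := hst _ S1x S2x.
  have [_ /(_ st1x) f1] := m1 _ S1x; have [_ /(_ st2x) f2] := m2 _ S2x.
  have c : (own x == ~~ e) = ~~ (own x == e) by case: (own x) (e) => [] [].
  rewrite c in f2; have [d [[? ?] [? ?]]] := force_meet f1 f2.
  by exists (succ x d).
apply: (@cond_conflict X X e (pr \o s) (r1 \o s) (r2 \o s) 0 K) => n _ /=.
- exact: prK.
- by case: (hs n) => _ [].
- by case: (hs n) => _ [].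
Qed.

(** Since the measures vanish outside [n] components starting at [l], measures of games with
    different priority ranges can be glued componentwise. *)
Definition determined_at (l n : nat) (st : X -> option bool)
    (R : (bool -> X -> Prop) * (bool -> X -> V)) : Prop :=
  [/\ forall e x, R.1 e x <-> ~ R.1 (~~ e) x,
      forall e, meas st e (R.1 e) (R.2 e)
    & forall e x j, ~~ (l <= j < l + n) -> R.2 e x j = OZ].

Definition cpre (a : bool) (Z : X -> Prop) (x : X) :=
  force (own x == a) (fun d => Z (succ x d)).

Lemma cpreN a (Z : X -> Prop) x :
  ~ cpre a Z x -> cpre (~~ a) (fun z => ~ Z z) x.
Proof.
move/forceN; rewrite /cpre.
by have -> : (own x == ~~ a) = ~~ (own x == a) by case: (own x) (a) => [] [].
Qed.

Section Step.
Variables (l n : nat) (st : X -> option bool).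
Hypothesis st_l : forall x, st x = None -> l <= pr x < l + n.+1.
Variable sol : (X -> option bool) -> (bool -> X -> Prop) * (bool -> X -> V).
Hypothesis sol_det : forall st', (forall x, st' x = None -> l.+1 <= pr x < l.+1 + n) ->
  determined_at l.+1 n st' (sol st').

Let a := ~~ odd l.

(** Cuts the game at its lowest priority [l], which is good for [a]: there [a] wins iff it can force
    the next position into [Z]. One priority fewer remains. *)
Definition stop_at (Z : X -> Prop) (x : X) : option bool :=
  if st x is Some c then Some c
  else if pr x == l then Some (if `[<cpre a Z x>] then a else ~~ a) else None.

Lemma stop_at_None Z x : st x = None -> pr x <> l -> stop_at Z x = None.
Proof. by rewrite /stop_at => -> /eqP/negPf->. Qed.

Lemma stop_at_cpre Z x c : st x = None -> pr x = l ->
  stop_at Z x <> Some (~~ c) -> if c == a then cpre a Z x else ~ cpre a Z x.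
Proof.
rewrite /stop_at => -> ->; rewrite eqxx.
by case: asboolP; case: c (a) => [] [].
Qed.

Lemma stop_at_Some Z x c : stop_at Z x <> Some c -> st x <> Some c.
Proof. by rewrite /stop_at => h E; rewrite E in h. Qed.

Lemma stop_at_det Z : determined_at l.+1 n (stop_at Z) (sol (stop_at Z)).
Proof.
apply: sol_det => x; rewrite /stop_at; case E: (st x) => [//|].
case: eqP => // /eqP ne _.
by have := st_l E; rewrite leq_eqVlt eq_sym (negPf ne) /= addSnnS.
Qed.

Lemma stop_at_conflict (Z Z' : X -> Prop) x :
  (forall z, Z z -> Z' z) ->
  (sol (stop_at Z)).1 a x -> (sol (stop_at Z')).1 (~~ a) x -> False.
Proof.
move=> ZZ' h h'; have [_ m _] := stop_at_det Z; have [_ m' _] := stop_at_det Z'.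
apply: (meas_conflict (m a) (m' (~~ a))) h h' => {}x h h'.
have [] := m a x h; have [] := m' (~~ a) x h'; rewrite /stop_at negbK.
case: (st x) => [c|]; first by case: c (a) => [] [].
case: eqP => // _; case: asboolP => [//|nZ' _ _]; case: asboolP => // hZ.
by case: nZ'; apply: force_mono hZ => d /ZZ'.
Qed.

(** Transfinite iteration towards the region of [~~ a]: at stage [o] the target of [a] is the
    complement of all earlier stages. *)
Definition stage : ord X -> X -> Prop :=
  Fix (@olt_wf X) (fun _ => X -> Prop) (fun o rec x =>
    (sol (stop_at (fun z => ~ exists o' (h : olt o' o), rec o' h z))).1 (~~ a) x).

Definition below o z := ~ exists o', olt o' o /\ stage o' z.

Lemma stageE o x : stage o x = (sol (stop_at (below o))).1 (~~ a) x.
Proof.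
rewrite /stage Fix_eq; last first.
  by move=> {}x f g fg; apply/funext => z; congr ((sol (stop_at _)).1 _ _);
    apply/funext => y; congr (~ _); apply/propext; split=> -[o' [h]];
    exists o', h; rewrite ?fg // -fg.
congr ((sol (stop_at _)).1 _ _); apply/funext => z; rewrite /below /stage.
by congr (~ _); apply/propext; split=> -[o' [h h']]; exists o'; [split|exists h].
Qed.

Definition never z := forall o, ~ stage o z.

(** The iteration closes: [ord_bound] gives an ordinal [o] above a stage for each position that has
    one, and there [below o] equals [never]. *)
Lemma stageP x : (sol (stop_at never)).1 (~~ a) x <-> exists o, stage o x.
Proof.
split=> [h|[o ho]]; last first.
  have [c _ _] := stop_at_det never; apply/c; rewrite negbK => h.
  rewrite stageE in ho; apply: (stop_at_conflict _ h ho) => z hz [o' [_]].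
  exact: hz.
have /choice[f hf] : forall z, exists o, (exists o', stage o' z) -> stage o z.
  move=> z; have [[o' h']|n'] := pselect (exists o', stage o' z).
    by exists o'.
  by exists OZ => /n'.
have [o ho] := ord_bound f; exists o; rewrite stageE.
suff -> : below o = never by [].
apply/funext => z; apply/propext; split=> [hz o' ho'|hz [o' [_]]].
  by apply: hz; exists (f z); split=> //; apply: hf; exists o'.
exact: hz.
Qed.

Lemma least_stage x : exists o, (exists o', stage o' x) ->
  stage o x /\ forall o', stage o' x -> ole o o'.
Proof.
have [[o0 h0]|n0] := pselect (exists o', stage o' x); last by exists OZ => /n0.
elim/(well_founded_ind (@olt_wf X)): o0 h0 => o IH ho.
have [[o' [lt ho']]|min] := pselect (exists o', olt o' o /\ stage o' x).
  exact: IH lt ho'.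
exists o => _; split=> // o' ho'; case: (ole_total o o') => // le.
by apply: contrapT => nle; apply: min; exists o'.
Qed.

(** Player [a] uses the measure of the game cut at [never]. Player [~~ a] uses the least stage of a
    position as component [l] and, for the rest, the measure of the game cut at that stage. *)
Lemma determined_step : exists R, determined_at l n.+1 st R.
Proof.
have /choice[rk hrk] := least_stage.
pose R := (sol (stop_at never)).1.
pose r (x : X) (j : nat) := if j == l then rk x
  else (sol (stop_at (below (rk x)))).2 (~~ a) x j.
pose rho e := if e == a then (sol (stop_at never)).2 a else r.
have [comp mI zI] := stop_at_det never.
exists (R, rho); split=> /=.
- exact: comp.
- move=> e; rewrite /rho; case: eqVneq => [->|].
    move=> x Rx; have [sx fx] := mI a x Rx.
    split=> [|E]; first exact: stop_at_Some sx.
    have [pl|pl] := pselect (pr x = l); last first.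
      exact/fx/stop_at_None.
    have := stop_at_cpre E pl sx; rewrite eqxx => hZ.
    apply: force_mono hZ => d nev; split.
      by apply/comp/stageP => -[o]; apply: nev.
    rewrite /cond pl /bad /a; case: ifP => [|_ q lt].
      by case: (odd l).
    apply/(@lex_congr _ _ _ _ (fun=> OZ) (fun=> OZ)); last exact: lex_refl.
    move=> j jq; left; rewrite !zI // negb_and -ltnNge ltnS;
      by rewrite (ltnW (leq_ltn_trans jq lt)).
  move=> ne; have -> : e = ~~ a by case: e (a) ne => [] [].
  move=> x /stageP Rx; have [hs min] := hrk x Rx.
  move: (hs); rewrite stageE => hs'.
  have [_ mo zo] := stop_at_det (below (rk x)).
  have [sx fx] := mo (~~ a) x hs'.
  split=> [|E]; first exact: stop_at_Some sx.
  have bl : bad (~~ a) l by rewrite /bad /a negbK.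
  have zr y j : j < l -> r y j = OZ.
    move=> lt; rewrite /r ltn_eqF //.
    by have [_ _ ->] := stop_at_det (below (rk y)) => //;
      rewrite negb_and -ltnNge ltnS (ltnW lt).
  (* The components before [l] vanish, so a drop of rank decides every comparison that reaches
     component [l]. *)
  have ltr y q : olt (rk y) (rk x) -> l <= q -> lexlt q (r y) (r x).
    move=> lt; elim: q => [|q IH].
      by rewrite leqn0 => /eqP l0; rewrite /lexlt /= /r l0.
    rewrite leq_eqVlt => /orP[/eqP lq|lq]; last first.
      exact: lexlt_mono (leqnSn _) (IH lq).
    move=> [_ hq]; have : ole (r x q.+1) (r y q.+1).
      apply: hq; apply/(@lex_congr _ _ _ _ (fun=> OZ) (fun=> OZ)); last exact: lex_refl.
      by move=> j jq; left; rewrite !zr // lq ltnS.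
    by rewrite /r -lq eqxx.
  have [pl|pl] := pselect (pr x = l).
    have na : (~~ a == a) = false by case: (a).
    have := stop_at_cpre E pl sx; rewrite na => hZ.
    apply: force_mono (cpreN hZ) => d /contrapT[o' [lt ho']].
    have hd : exists o, stage o (succ x d) by exists o'.
    split; first exact/stageP.
    rewrite /cond pl bl; apply: ltr => //.
    by have [_ /(_ _ ho') le] := hrk _ hd; apply: ole_lt_trans le lt.
  have lp : l < pr x.
    by case/andP: (st_l E); rewrite leq_eqVlt eq_sym => /orP[/eqP/pl|].
  move: (fx (stop_at_None _ E pl)).
  apply: force_mono => d [hd cd].
  have hd' : exists o, stage o (succ x d) by exists (rk x); rewrite stageE.
  split; first exact/stageP.
  have [hsd mind] := hrk _ hd'.
  have le : ole (rk (succ x d)) (rk x) by apply: mind; rewrite stageE.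
  (* The rank does not grow. If it ties, both positions belong to the same cut game, whose measure
     decides. *)
  have [ge|lt] := pselect (ole (rk x) (rk (succ x d))); last first.
    rewrite /cond; case: ifP => _; first exact: ltr (ltnW lp).
    move=> q qp; have [lq|ql] := leqP l q; first exact/lexltW/ltr.
    apply/(@lex_congr _ _ _ _ (fun=> OZ) (fun=> OZ)); last exact: lex_refl.
    by move=> j jq; left; rewrite !zr // (leq_ltn_trans jq ql).
  have eb : below (rk (succ x d)) = below (rk x).
    apply/funext => z; rewrite /below; congr (~ _); apply/propext.
    by split=> -[o' [lt ho']]; exists o'; split=> //;
      [exact: olt_le_trans lt le|exact: olt_le_trans lt ge].
  have cg q : forall y y', (y = x /\ y' = succ x d) \/ (y' = x /\ y = succ x d) ->
      lex q (r y) (r y') <-> lex q ((sol (stop_at (below (rk x)))).2 (~~ a) y)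
        ((sol (stop_at (below (rk x)))).2 (~~ a) y').
    move=> y y' yy'; apply: lex_congr => j jq; rewrite /r.
    case: eqP => [->|_].
      right; rewrite !zo ?negb_and -?ltnNge ?leqnn //; split=> //;
        by case: yy' => -[-> ->].
    by left; case: yy' => -[-> ->]; rewrite eb.
  move: cd; rewrite /cond; case: ifP => _.
    by move=> h1 h2; apply: h1; apply: (cg _ _ _ _).1 h2; left.
  by move=> h1 q /h1 h2; apply: (cg _ _ _ _).2 h2; right.
- move=> e x j hj; have hj' : ~~ (l.+1 <= j < l.+1 + n).
    apply: contra hj => /andP[h1 h2]; rewrite (ltnW h1) /=.
    by rewrite addnS -addSn.
  rewrite /rho; case: ifP => _; first exact: zI.
  rewrite /r; case: eqP hj => [->|_ _].
    by rewrite leqnn /= addnS ltnS leq_addr.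
  by have [_ _ ->] := stop_at_det (below (rk x)).
Qed.

End Step.

Theorem parity_determinacy l n st :
  (forall x, st x = None -> l <= pr x < l + n) ->
  exists R, determined_at l n st R.
Proof.
elim: n l st => [|n IH] l st hst.
  have term x : st x <> None by move=> /hst; rewrite addn0 leqNgt; case: ltnP.
  exists (fun e x => st x = Some e, fun _ _ _ => OZ); split=> //=.
    move=> e x; case E: (st x) => [c|]; last by case: (term x).
    by case: c e {E} => [] []; split=> //= [[]].
  by move=> e x /= E; rewrite E; split=> //; case: e {E}.
have /choice[sol hsol] : forall st' : X -> option bool, exists R,
    (forall x, st' x = None -> l.+1 <= pr x < l.+1 + n) ->
    determined_at l.+1 n st' R.
  move=> st'; have [h|nh] := pselect (forall x, st' x = None ->
    l.+1 <= pr x < l.+1 + n); last by exists (fun _ _ => True, fun _ _ _ => OZ).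
  by have [R hR] := IH _ _ h; exists R.
exact: (determined_step hst hsol).
Qed.

End Games.

(** * Signatures and their comparison *)

Section Signature.
Variables (X : Type) (own : X -> bool) (succ : X -> bool -> X).
Variables (pr : X -> nat) (K : nat).
Hypothesis prK : forall x, 0 < pr x <= K.

Local Notation V := (vec X).
Local Notation winning := (meas own succ pr (fun=> None) true).

Definition won (x : X) := exists S rho, winning S rho /\ S x.

Definition is_sig (sig : X -> V) :=
  (forall x S rho, winning S rho -> S x -> lex K (sig x) (rho x)) /\
  winning won sig.

(** Each value is a minimum over all measures. As [cond] survives lowering the value at the
    successor, these minima again form a measure. *)
Lemma sig_exists : exists sig, is_sig sig.
Proof.
have /choice[sig hsig] : forall x, exists f, won x ->
    (exists S rho, [/\ winning S rho, S x & rho x = f]) /\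
    forall S rho, winning S rho -> S x -> lex K f (rho x).
  move=> x; have [[S0 [r0 [w0 S0x]]]|nw] := pselect (won x); last first.
    by exists (fun=> OZ) => /nw.
  have : exists S rho, [/\ winning S rho, S x & rho x = r0 x].
    by exists S0, r0.
  elim/(well_founded_ind (@lexlt_wf X K)): (r0 x) => f IH hf.
  have [[g [gf hg]]|min] := pselect (exists g, lexlt K g f /\
      exists S rho, [/\ winning S rho, S x & rho x = g]); first exact: IH hg.
  exists f => _; split=> // S rho w Sx; case: (lex_total K f (rho x)) => // le.
  apply: contrapT => nle; apply: min; exists (rho x).
  by split=> //; exists S, rho.
exists sig; split=> [x S rho w Sx|x wx].
  by have [|_ h] := hsig x; [exists S, rho|apply: h Sx].
split=> // _; have [[S [rho [w Sx <-]]] _] := hsig x wx.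
have [_ /(_ erefl)] := w x Sx; apply: force_mono => d [Sd cd].
have wd : won (succ x d) by exists S, rho.
split=> //; apply: cond_le cd; last exact: lex_refl.
have [_ /(_ _ _ w Sd)] := hsig _ wd; apply: lex_mono.
by case/andP: (prK x).
Qed.

Variable sig : X -> V.
Hypothesis sigP : is_sig sig.

Lemma sig_force x : won x -> force (own x) (fun d => won (succ x d) /\
  cond true (pr x) (sig (succ x d)) (sig x)).
Proof. by case: sigP => _ h /h[_ /(_ erefl)]; rewrite eqb_id. Qed.

(* The pointwise minimum of [sig] and [h] is again a progress measure. *)
Lemma sig_extend (S : X -> Prop) (h : X -> V) :
  (forall x, S x -> (won x /\ lex K (sig x) (h x)) \/
    force (own x) (fun d => exists f,
      ((won (succ x d) /\ f = sig (succ x d)) \/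
       (S (succ x d) /\ f = h (succ x d))) /\ cond true (pr x) f (h x))) ->
  forall x, S x -> won x /\ lex K (sig x) (h x).
Proof.
move=> hS.
(* [sig] is used at won positions where it does not exceed [h] or where [S] fails, and [h]
   elsewhere. *)
pose useS x := won x /\ (S x -> lex K (sig x) (h x)).
pose rho x := if `[<useS x>] then sig x else h x.
have le1 x : won x -> lex K (rho x) (sig x).
  move=> wx; rewrite /rho; case: asboolP => [_|nu]; first exact: lex_refl.
  apply: lexltW => le; apply: nu; split=> //.
have le2 x : S x -> lex K (rho x) (h x).
  by move=> Sx; rewrite /rho; case: asboolP => [[_ /(_ Sx)] //|_]; apply: lex_refl.
have prle x : pr x <= K by case/andP: (prK x).
have w : winning (fun x => won x \/ S x) rho.
  move=> x hx; split=> // _; rewrite eqb_id.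
  have [[wx ux]|nu] := pselect (useS x).
    have -> : rho x = sig x by rewrite /rho asboolT.
    apply: force_mono (sig_force wx) => d [wd cd]; split; first by left.
    by apply: cond_le cd; [apply/(lex_mono (prle x))/le1|apply: lex_refl].
  have -> : rho x = h x by rewrite /rho asboolF.
  have Sx : S x.
    by case: hx => // wx; apply: contrapT => nS; apply: nu.
  case: (hS x Sx) => [[wx lx]|]; first by case: nu.
  apply: force_mono => d [f [hf cd]]; split; first by case: hf => -[]; [left|right].
  apply: cond_le cd; [apply: (lex_mono (prle x))|exact: lex_refl].
  by case: hf => -[? ->]; [apply: le1|apply: le2].
move=> x Sx; have wx : won x by exists (fun x => won x \/ S x), rho; split=> //; right.
split=> //; apply: lex_trans (le2 _ Sx).
by case: sigP => least _; apply: least w _; right.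
Qed.

Definition atmost m s x := won x /\ lex m (sig x) s.
Definition less m s x := won x /\ lexlt m (sig x) s.

Definition trunc (l : nat) (s : V) : V := fun j => if j <= l then s j else OZ.

Lemma trunc_le l m s : lex m (trunc l s) s.
Proof.
elim: m => [|m IH] /=; rewrite /trunc; first by rewrite leq0n; apply: ole_refl.
by split=> // _; case: ifP => // _; apply: ole_refl.
Qed.

Lemma trunc_lexE l m s f : m <= l -> (lex m f (trunc l s) <-> lex m f s) /\
  (lex m (trunc l s) f <-> lex m s f).
Proof.
by move=> ml; split; apply: lex_congr => j jm; left; rewrite /trunc (leq_trans jm ml).
Qed.

(** [sig_extend] for the single position [x] with value [trunc l s]: one move that makes progress
    from this value already bounds the signature. *)
Lemma atmost_trunc l m s x : m <= K ->
  force (own x) (fun d => won (succ x d) /\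
    cond true (pr x) (sig (succ x d)) (trunc l s)) -> atmost m s x.
Proof.
move=> mK h; have [|wx le] := @sig_extend (fun z => z = x) (fun=> trunc l s) _ x erefl.
  move=> _ ->; right; apply: force_mono h => d [wd cd].
  by exists (sig (succ x d)); split=> //; left.
split=> //; exact: lex_trans (lex_mono mK le) (trunc_le _ _ _).
Qed.

Lemma atmost_odd m s x : m <= K -> odd (pr x) -> ~ atmost m s x ->
  force (~~ own x) (fun d => ~ less (pr x) s (succ x d)).
Proof.
move=> mK op na; apply: forceN => h; apply: na.
apply: (@atmost_trunc (pr x)) => //; apply: force_mono h => d [wd lt]; split=> //.
rewrite /cond /bad op eqxx => le; apply: lt.
by apply: (proj1 (proj2 (trunc_lexE _ _ _))) le.
Qed.

Lemma atmost_even m s x : m <= K -> ~~ odd (pr x) -> ~ atmost m s x ->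
  force (~~ own x) (fun d => ~ atmost (pr x).-1 s (succ x d)).
Proof.
move=> mK op na; apply: forceN => h; apply: na.
apply: (@atmost_trunc (pr x).-1) => //; apply: force_mono h => d [wd le]; split=> //.
rewrite /cond /bad (negPf op) => q lt; apply: (proj2 (proj1 (trunc_lexE _ _ _))).
  by rewrite -ltnS prednK //; case/andP: (prK x).
by apply: lex_mono le; rewrite -ltnS prednK //; case/andP: (prK x).
Qed.

(** The inner game runs only through priorities above [m]. A smaller one ends it, and the comparison
    of the signature there with [s] decides. *)
Definition inner_stop m s (x : X) : option bool :=
  if pr x <= m then Some `[<atmost m s x>] else None.

Lemma inner_determined m s : m <= K ->
  exists R, determined_at own succ pr m.+1 (K - m) (inner_stop m s) R.
Proof.
move=> mK; apply: (@parity_determinacy _ _ _ _ K) => x.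
  by case/andP: (prK x).
rewrite /inner_stop; case: leqP => // lt _.
by rewrite addSn subnKC // ltnS; case/andP: (prK x).
Qed.

(* Otherwise the protagonist's inner measure, put below the components of [s]
   up to [m], would improve on the least measure. *)
Lemma inner_antagonist m s R x : m <= K ->
  determined_at own succ pr m.+1 (K - m) (inner_stop m s) R ->
  ~ atmost m s x -> R.1 false x.
Proof.
move=> mK [comp mI zI] na; apply/comp => /= Rx; apply: na.
pose h z : V := fun j => if j <= m then s j else R.2 true z j.
have hs z f : (lex m f (h z) <-> lex m f s) /\ (lex m (h z) f <-> lex m s f).
  by split; apply: lex_congr => j jm; left; rewrite /h jm.
have hh q z z' : lex q (h z) (h z') <-> lex q (R.2 true z) (R.2 true z').
  apply: lex_congr => j _; rewrite /h; case: leqP => [jm|_]; last by left.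
  right; rewrite !zI ?negb_and -?ltnNge ?ltnS ?jm //.
  by split=> //; apply: ole_refl.
have [|wx le] := @sig_extend (R.1 true) h _ x Rx.
  move=> z Rz; have [sz fz] := mI true z Rz.
  have [pm|pm] := leqP (pr z) m; last first.
    right; have := fz; rewrite /inner_stop leqNgt pm /= eqb_id => /(_ erefl).
    apply: force_mono => d [Rd cd]; exists (h (succ z d)); split; first by right.
    move: cd; rewrite /cond; case: ifP => _; first by move=> lt /hh.
    by move=> lq q /lq /hh.
  have [wz lz] : atmost m s z.
    by apply: contrapT => na; apply: sz; rewrite /inner_stop pm asboolF.
  have [le|nle] := pselect (lex K (sig z) (h z)); first by left.
  right; apply: force_mono (sig_force wz) => d [wd cd].
  exists (sig (succ z d)); split; first by left.
  apply: cond_le cd; first exact: lex_refl.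
  by apply: (lex_mono pm); apply/(hs z _).1.
by split=> //; apply: (proj1 (proj1 (hs x _))); apply: lex_mono le.
Qed.

End Signature.

(** After a move at priority [p], a claim about the components up to [m] continues up to [lev m p],
    which stays odd. [sw m p] says that the claim changes between weak and strict, after which the
    other game advances. *)
Definition lev (m p : nat) := if p <= m then (if odd p then p else p.-1) else m.
Definition sw (m p : nat) := odd p && (p <= m).

Lemma lev_le m p : lev m p <= m.
Proof.
by rewrite /lev; case: ifP => // pm; case: ifP => // _; exact: leq_trans (leq_pred _) pm.
Qed.

Lemma lev_odd m p : 0 < p -> odd m -> odd (lev m p).
Proof.
rewrite /lev; case: p => //= p _ om.
by case: ifP => // _; case: ifP => //= /negbFE.
Qed.

(** At a stable level, priorities below [m] no longer occur, and [m] occurs exactly at the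
    switches. *)
Lemma lev_fix m p : 0 < p -> lev m p = m -> if sw m p then p = m else m < p.
Proof.
move=> p0; rewrite /lev /sw; case: (leqP p m) => pm; rewrite ?andbT ?andbF //.
by case: (odd p) => //= E; move: pm; rewrite -E leqNgt ltn_predL p0.
Qed.

Lemma nonincreasing_const (m : nat -> nat) :
  (forall n, m n.+1 <= m n) -> exists N, forall n, N <= n -> m n = m N.
Proof.
move=> h; have ex : exists v, `[<exists n, m n = v>].
  by exists (m 0); apply/asboolP; exists 0.
case: (ex_minnP ex) => v /asboolP[N EN] min; exists N => n Nn.
apply/eqP; rewrite eqn_leq; apply/andP; split; last first.
  by rewrite EN; apply: min; apply/asboolP; exists n.
elim: n Nn => [|n IH]; first by rewrite leqn0 => /eqP->.
rewrite leq_eqVlt => /orP[/eqP-> //|/IH]; exact: leq_trans.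
Qed.

(** * Soundness of the comparison game *)

Section Comparison.
Variables (X : Type) (own : X -> bool) (succ : X -> bool -> X).
Variables (pr : X -> nat) (K : nat).
Hypothesis prK : forall x, 0 < pr x <= K.
Variable sig : X -> vec X.
Hypothesis sigP : is_sig own succ pr K sig.

Local Notation won := (won own succ pr).
Local Notation atmost := (atmost own succ pr sig).
Local Notation less := (less own succ pr sig).

(* [(x, y, m, true)] is the claim that the signature of [x] is at most that of
   [y] on the components up to [m], and [(x, y, m, false)] that it is smaller. *)
Definition cpos := (X * X * nat * bool)%type.

Definition cact (q : cpos) : X := let: (x, y, m, b) := q in if b then x else y.
Definition csw (q : cpos) : bool := let: (x, y, m, b) := q in sw m (pr (cact q)).
Definition cown (q : cpos) : bool :=
  let: (x, y, m, b) := q in if b then own x else ~~ own y.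
(** Lowering by one dualises the second game. For odd [m] the value [1] is the least possible, so a
    claimant who switches forever loses. *)
Definition cprio (q : cpos) : nat :=
  if csw q then 1 else if q.2 then pr (cact q) else (pr (cact q)).-1.
Definition csucc (q : cpos) (d : bool) : cpos :=
  let: (x, y, m, b) := q in
  (if b then succ x d else x, if b then y else succ y d,
   lev m (pr (cact q)), b (+) csw q).

Definition cinv (q : cpos) : Prop := let: (x, y, m, b) := q in
  [/\ odd m, m <= K, won x
    & if b then ~ less m (sig x) y else ~ atmost m (sig x) y].

(** The claimant of a true claim follows [sig] in the first game and the antagonist's inner measure
    in the second; a measure [r] of the opponent conflicts with one of these. *)
Lemma comparison_won (J : Type) (S : cpos -> Prop) (r : cpos -> vec J) q :
  (forall q, S q -> force (~~ cown q) (fun d => S (csucc q d) /\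
     cond false (cprio q) (r (csucc q d)) (r q))) ->
  cinv q -> S q -> False.
Proof.
move=> hS iq Sq.
have /choice[H hH] : forall ms : nat * vec X, exists R, ms.1 <= K ->
    determined_at own succ pr ms.1.+1 (K - ms.1)
      (inner_stop own succ pr sig ms.1 ms.2) R.
  move=> [m s]; have [mK|_] := boolP (m <= K); last first.
    by exists (fun _ _ => True, fun _ _ _ => OZ).
  by have [R hR] := inner_determined own succ prK sig s mK; exists R.
(* For a strict claim, [y] is kept in the antagonist's region of the inner game, which supplies the
   measure to follow. *)
pose inv (q : cpos) : Prop := let: (x, y, m, b) := q in
  [/\ odd m, m <= K, won x
    & if b then ~ less m (sig x) y else (H (m, sig x)).1 false y].
have inner m s x : m <= K -> ~ atmost m s x -> (H (m, s)).1 false x.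
  by move=> mK; apply: (inner_antagonist prK sigP mK (hH (m, s) mK)).
have {}iq : inv q.
  move: q iq {Sq} => [[[x y] m] []] //= [om mK wx na]; split=> //.
  exact: inner.
pose info (q : cpos) d : Prop := let: (x, y, m, b) := q in
  if b then cond true (pr x) (sig (succ x d)) (sig x)
  else m < pr y -> cond false (pr y) ((H (m, sig x)).2 false (succ y d))
    ((H (m, sig x)).2 false y).
have step p : inv p -> force (cown p) (fun d => inv (csucc p d) /\ info p d).
  move: p => [[[x y] m] b] /= [om mK wx]; case: b => /=.
    move=> nl; apply: force_mono (sig_force sigP wx) => d [wd cd]; split=> //.
    have px0 : 0 < pr x by case/andP: (prK x).
    split=> //; [exact: lev_odd|exact: leq_trans (lev_le _ _) mK|].
    rewrite /sw /lev; case: leqP => pm; rewrite ?andbT ?andbF /=; last first.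
      by move=> [wy lt]; apply: nl; split=> //;
        apply: lexlt_le_trans lt (cond_lex cd pm).
    move: cd; rewrite /cond /bad eqb_id; case: ifP => op lt /=.
      apply: inner; first exact: leq_trans pm mK.
      move=> [wy le]; apply: nl; split=> //; apply: (lexlt_mono pm).
      exact: lex_lt_trans le lt.
    move=> [wy lt']; apply: nl; split=> //.
    apply: (@lexlt_mono _ (pr x).-1); first exact: leq_trans (leq_pred _) pm.
    by apply: lexlt_le_trans lt' (lt _ _); rewrite prednK.
  move=> Hy; have [comp mI _] := hH (m, sig x) mK.
  have py0 : 0 < pr y by case/andP: (prK y).
  have [/= sy fy] := mI false y Hy.
  have lK : lev m (pr y) <= K by exact: leq_trans (lev_le _ _) mK.
  have [pm|pm] := leqP (pr y) m; last first.
    have := fy; rewrite /inner_stop leqNgt pm /= => /(_ erefl).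
    rewrite eqbF_neg; apply: force_mono => d [Hd cd]; split=> //.
    rewrite /sw /lev leqNgt pm andbF /=; split=> //.
  have na : ~ atmost m (sig x) y.
    by move=> h; apply: sy; rewrite /inner_stop pm asboolT.
  have [op|op] := boolP (odd (pr y)).
    apply: force_mono (atmost_odd prK sigP mK op na) => d nl; split=> //.
    by split=> //; [exact: lev_odd|rewrite /sw /lev op pm].
  apply: force_mono (atmost_even prK sigP mK op na) => d nl; split=> //.
  split=> //; first exact: lev_odd.
  by rewrite /sw (negPf op) /=; apply: inner => //; rewrite /lev pm (negPf op).
have [|//|s [_ hs]] := @step_sequence cpos (fun p => inv p /\ S p)
  (fun p p' => exists d, [/\ p' = csucc p d, info p d &
     cond false (cprio p) (r p') (r p)]) q.
  move=> p [ip Sp]; have [d [[i1 i2] [S1 S2]]] := force_meet (step p ip) (hS p Sp).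
  by exists (csucc p d); split=> //; exists d.
pose b n := (s n).2; pose m n := (s n).1.2.
pose x n := (s n).1.1.1; pose y n := (s n).1.1.2.
pose p n := pr (cact (s n)).
have sE n : s n = (x n, y n, m n, b n).
  by rewrite /x /y /m /b; case: (s n) => [[[? ?] ?] ?].
have pE n : p n = if b n then pr (x n) else pr (y n).
  by rewrite /p sE /=; case: (b n).
have p0 n : 0 < p n by case/andP: (prK (cact (s n))).
have pK n : p n <= K by case/andP: (prK (cact (s n))).
have mS n : m n.+1 = lev (m n) (p n).
  by have [_ [d [E _ _]]] := hs n; rewrite /m /p E; case: (s n) => [[[? ?] ?] ?].
have bS n : b n.+1 = b n (+) sw (m n) (p n).
  by have [_ [d [E _ _]]] := hs n; rewrite /b /m /p E; case: (s n) => [[[? ?] ?] ?].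
have cprioE n : cprio (s n) = if sw (m n) (p n) then 1
    else if b n then p n else (p n).-1.
  by rewrite /cprio /p; rewrite sE /=.
have xt n : b n -> cond true (p n) (sig (x n.+1)) (sig (x n)).
  move=> bn; have [_ [d [E i _]]] := hs n.
  by move: i; rewrite pE bn /x E sE /= bn.
have xf n : ~~ b n -> x n.+1 = x n.
  by move=> bn; have [_ [d [E _ _]]] := hs n; rewrite /x E sE /= (negPf bn).
have yf n : ~~ b n -> m n < p n ->
    cond false (p n) ((H (m n, sig (x n))).2 false (y n.+1))
      ((H (m n, sig (x n))).2 false (y n)).
  move=> bn; have [_ [d [E i _]]] := hs n.
  by move: i; rewrite pE (negPf bn) /y E sE /= (negPf bn).
have rc n : cond false (cprio (s n)) (r (s n.+1)) (r (s n)).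
  by have [_ [d [_ _ ?]]] := hs n.
have om n : odd (m n).
  by have [[+ _] _] := hs n; rewrite sE => -[].
have [N mN] : exists N, forall n, N <= n -> m n = m N.
  by apply: nonincreasing_const => n; rewrite mS lev_le.
have lf n : N <= n -> if sw (m N) (p n) then p n = m N else m N < p n.
  by move=> Nn; apply: lev_fix => //; rewrite -{1}(mN n Nn) -mS mN // leqW.
have fin : ~ inf_often (fun n => b n && sw (m n) (p n)).
  (* [K.*2.+2] stands for the moves of the second game: it is even, so the unchanged first position
     counts as progress, and it exceeds the level. Recurring switches would make the odd [m N] the
     least recurring priority. *)
  move=> inf; pose a n := if b n then p n else K.*2.+2.
  have /negP[] : ~~ bad true (m N); last by rewrite /bad om.
  apply: (@cond_sound X true a (sig \o x) N).
  - move=> n _ /=; rewrite /a; case: (boolP (b n)) => [/xt //|/xf ->].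
    by rewrite /cond /bad /= negbK odd_double => v _; apply: lex_refl.
  - move=> n; have [k [nk /andP[bk sk]]] := inf (maxn n N).
    move: nk; rewrite geq_max => /andP[nk Nk].
    by exists k; split=> //; rewrite /a bk; have := lf k Nk; rewrite -(mN k Nk) sk.
  - move=> v vm hv; have [k [Nk]] := hv N; rewrite /a.
    case: ifP => bk E.
      by have := lf k Nk; case: ifP => _; rewrite E => h; move: vm;
        rewrite ?h ?ltnn // ltnNge ltnW.
    have : m N <= K by have [[+ _] _] := hs N; rewrite sE => -[].
    rewrite leqNgt => /negP; apply; apply: leq_ltn_trans vm.
    by rewrite -E -addnn; apply: leq_trans (leq_addr K K) (leqW (leqnSn _)).
have /existsNP[N1 /forallNP hN1] := fin.
pose N2 := maxn N N1.
have nosw n : N2 <= n -> ~~ (b n && sw (m n) (p n)).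
  rewrite geq_max => /andP[_ N1n]; apply/negP => h.
  by apply: (hN1 n); split.
(* No further switch leaves the first game. Either it advances forever, where [sig] conflicts with
   [r], or the second one does, above the level and with shifted priorities. *)
have [[n0 [Nn0 bn0]]|nob] := pselect (exists n, N2 <= n /\ b n).
  have bt n : n0 <= n -> b n /\ ~~ sw (m n) (p n).
    move=> n0n; suff bn : b n.
      by split=> //; have := nosw n (leq_trans Nn0 n0n); rewrite bn.
    elim: n n0n => [|n IH]; first by rewrite leqn0 => /eqP <-.
    rewrite leq_eqVlt => /orP[/eqP <- //|n0n].
    have := nosw n (leq_trans Nn0 n0n); rewrite bS (IH n0n) /=.
    by move=> /negPf ->.
  apply: (@cond_conflict X J true p (sig \o x) (r \o s) n0 K) => n n0n //=.
    by apply: xt; case: (bt n n0n).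
  by have := rc n; rewrite cprioE; have [-> /negPf ->] := bt n n0n.
have bf n : N2 <= n -> ~~ b n by move=> h; apply/negP => bn; apply: nob; exists n.
have nsf n : N2 <= n -> ~~ sw (m n) (p n).
  by move=> h; have := bf n.+1 (leqW h); rewrite bS (negPf (bf n h)).
apply: (@cond_conflict_pred X J false p
  (fun n => (H (m n, sig (x n))).2 false (y n)) (r \o s) N2 K) => n N2n /=.
- by rewrite p0 pK.
- have Nn : N <= n by exact: leq_trans (leq_maxl _ _) N2n.
  rewrite (mN n.+1 (leqW Nn)) -(mN n Nn) (xf n (bf n N2n)).
  apply: yf (bf n N2n) _.
  by have := lf n Nn; rewrite -(mN n Nn) (negPf (nsf n N2n)).
- by have := rc n; rewrite cprioE (negPf (nsf n N2n)) (negPf (bf n N2n)).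
Qed.

End Comparison.

(** * The unambiguous automaton *)

Lemma parity_winP (a : nat -> nat) :
  parity_win (fun n => Some (a n)) <-> exists q, ~~ odd q /\ min_inf a q.
Proof.
have E p : inf_often (fun n => Some (a n) = Some p) <-> inf_often (fun n => a n = p).
  by split=> h n; have [m [le]] := h n; [case=> ?|move=> ?];
    exists m; split=> //; congr Some.
split=> -[q [oq [inf min]]]; exists q; split=> //; split; try exact/E.
  by move=> p pq /E; apply: min.
by move=> p pq /E; apply: min.
Qed.

Lemma inf_often_eventually (P Q : nat -> Prop) N :
  (forall n, N <= n -> P n -> Q n) -> inf_often P -> inf_often Q.
Proof.
move=> h inf n; have [m []] := inf (maxn n N); rewrite geq_max => /andP[nm Nm] Pm.
by exists m; split=> //; apply: h.
Qed.

Lemma inf_often_shiftE (P : nat -> Prop) N :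
  inf_often (fun n => P (N + n)) <-> inf_often P.
Proof.
split=> h n.
  have [m [le Pm]] := h n; exists (N + m); split=> //.
  exact: leq_trans le (leq_addl _ _).
have [m [le Pm]] := h (N + n); exists (m - N); split.
  by rewrite leq_subRL // (leq_trans (leq_addr n N)).
by rewrite subnKC // (leq_trans (leq_addr n N)).
Qed.

Lemma min_inf_shift a q N : min_inf a q <-> min_inf (fun n => a (N + n)) q.
Proof.
have E p := inf_often_shiftE (fun n => a n = p) N.
split=> -[inf min]; split.
- exact/E.
- by move=> p /min h /E.
- exact/E.
- by move=> p /min h /E.
Qed.

Lemma min_inf_unique a q q' : min_inf a q -> min_inf a q' -> q = q'.
Proof.
by move=> [i m] [i' m']; case: (ltngtP q q') => // [/m'|/m].
Qed.

Lemma min_inf_succ a b q N : (forall n, N <= n -> b n = (a n).+1) ->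
  min_inf a q -> min_inf b q.+1.
Proof.
move=> E [inf min]; split.
  by apply: (@inf_often_eventually _ _ N) inf => n Nn <-; apply: E.
case=> [|p] pq hp.
  by have [n [Nn]] := hp N; rewrite E.
apply: (min p) => //; apply: (@inf_often_eventually _ _ N) hp => n Nn.
by rewrite E // => -[].
Qed.

Lemma min_inf_ext a b q N : (forall n, N <= n -> b n = a n) ->
  min_inf a q -> min_inf b q.
Proof.
move=> E [inf min]; split.
  by apply: (@inf_often_eventually _ _ N) inf => n Nn <-; apply: E.
move=> p pq hp; apply: (min p) => //.
by apply: (@inf_often_eventually _ _ N) hp => n Nn; rewrite E.
Qed.

Lemma min_inf_eventually a q p : min_inf a q -> p < q ->
  exists N, forall n, N <= n -> p < a n.
Proof.
move=> [_ min] pq; apply: eventually_ge => v vp; apply: min.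
exact: leq_trans vp pq.
Qed.

Section Automaton.
Variable K : nat.

(* A letter records the owner of a position, the tag of the player that reads
   the number [p] as [p + 2] while the other reads it as [p + 1] (without tag
   both read [1]), and the number [p]. *)
Definition letter := (bool * option bool * 'I_K.+1)%type.
Definition arity (_ : letter) := 3.
Definition lown (a : letter) : bool := a.1.1.
Definition ltag (a : letter) : option bool := a.1.2.
Definition prio (R : bool) (a : letter) : nat :=
  if ltag a is Some t then (if t == R then a.2.+2 else a.2.+1) else 1.

Lemma prio_bound R a : 0 < prio R a <= K.+2.
Proof.
rewrite /prio; case: (ltag a) => [t|] //; have := ltn_ord a.2.
by case: ifP => //= _ /ltnW.
Qed.

(* [None] accepts everything; [Some (R, t, e)] claims that player [R] wins,
   [t] is the tag of the letter above and [e] the emitted priority. *)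
Definition state := option (bool * option bool * 'I_K.+3).

(** The odd value [1] at a change of tag forces the tags to settle on an accepting branch that keeps
    following one player; from then on the two players' readings differ by one. *)
Definition emis (R : bool) (t : option bool) (a : letter) : nat :=
  if t == ltag a then prio R a else 1.

Lemma emis_bound R t a : 0 < emis R t a <= K.+2.
Proof. by rewrite /emis; case: ifP => // _; apply: prio_bound. Qed.

Definition follow R t a : state := Some (R, ltag a, inord (emis R t a)).
(** Priority [0] makes a branch that enters auxiliary games infinitely often accepting. *)
Definition restart R : state := Some (R, None, ord0).

(** The single bit [c] fixes both the move of the claimed winner and the player claimed to win child
    2. *)
Definition kids (s : state) (a : letter) (c : bool) : seq state :=
  if s is Some (R, t, _) then
    if lown a == R then
      if c then [:: follow R t a; None; restart R]
      else [:: None; follow R t a; restart (~~ R)]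
    else [:: follow R t a; follow R t a; None]
  else [:: None; None; None].

Definition aut : NPTA letter arity := {|
  nQ := state;
  ninit := fun s => s == restart true;
  ntrans := fun s a f =>
    [exists c, f == [ffun d : 'I_3 => nth None (kids s a c) d]];
  nprio := fun s => if s is Some (_, _, e) then e : nat else 0 |}.

Lemma nrunP t rho : @nrun _ _ aut t rho <-> rho [::] = restart true /\
  forall u a, t u = Some a -> exists c, forall d, d < 3 ->
    rho (rcons u d) = nth None (kids (rho u) a c) d.
Proof.
rewrite /nrun /=; split=> -[/eqP r0 h]; split=> // u a /h.
  move=> /existsP[c /eqP E]; exists c => d d3.
  by have /ffunP/(_ (Ordinal d3)) := E; rewrite !ffunE.
by move=> [c hc]; apply/existsP; exists c; apply/eqP/ffunP => d; rewrite !ffunE hc.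
Qed.

Lemma branch_of_nodes (u : nat -> seq nat) (d : nat -> nat) :
  (forall n, u n.+1 = rcons (u n) (d n)) ->
  exists beta, forall n, mkseq beta (size (u 0) + n) = u n.
Proof.
move=> hu; exists (fun i => if i < size (u 0) then nth 0 (u 0) i
  else d (i - size (u 0))).
elim=> [|n IH].
  rewrite addn0 -[RHS](mkseq_nth 0); apply/eq_in_map => i.
  by rewrite mem_iota add0n => /andP[_ ->].
rewrite addnS mkseqS IH hu; congr rcons.
by rewrite ltnNge leq_addr /= addKn.
Qed.

Lemma tree_mkseq t beta n m : is_tree arity t -> n <= m ->
  t (mkseq beta m) <> None -> t (mkseq beta n) <> None.
Proof.
move=> [_ cl _]; elim: m => [|m IH]; first by rewrite leqn0 => /eqP->.
rewrite leq_eqVlt => /orP[/eqP-> //|/IH h]; rewrite mkseqS -cats1.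
by move/cl/h.
Qed.

(** An even limit exceeds [1], so the tags settle; afterwards the two emitted sequences differ by
    one and cannot both have even limits. *)
Lemma emis_disjoint R (t : nat -> option bool) (a : nat -> letter) q q' :
  (forall n, t n.+1 = ltag (a n)) ->
  min_inf (fun n => emis R (t n) (a n)) q ->
  min_inf (fun n => emis (~~ R) (t n) (a n)) q' -> ~~ odd q -> ~~ odd q' -> False.
Proof.
move=> ht mq mq' oq oq'.
have q1 : 1 < q.
  have [n [_ En]] := mq.1 0; move: oq; rewrite -En.
  by case/andP: (emis_bound R (t n) (a n)); case: (emis _ _ _) => [|[]].
have [N hN] := min_inf_eventually mq q1.
have tag n : N <= n -> exists b, t n = Some b /\ ltag (a n) = Some b.
  move=> /hN; rewrite /emis /prio; case: eqP => // ->.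
  by case: (ltag (a n)) => // b _; exists b.
have [b [tN _]] := tag N (leqnn N).
have tagb n : N <= n -> t n = Some b /\ ltag (a n) = Some b.
  elim: n => [|n IH]; first by rewrite leqn0 => /eqP E; have [c] := tag N (leqnn N);
    rewrite -E in tN *; rewrite tN => -[[<-]].
  rewrite leq_eqVlt => /orP[/eqP E|Nn].
    by have [c] := tag N (leqnn N); rewrite -E tN => -[[<-]].
  have [c [t1 t2]] := tag n.+1 (leqW Nn); have [_ t3] := IH Nn.
  by move: t1 t2; rewrite ht t3 => -[<-].
have E n : N <= n -> (emis R (t n) (a n) = if b == R then (a n).2.+2 else (a n).2.+1)
    /\ (emis (~~ R) (t n) (a n) = if b == ~~ R then (a n).2.+2 else (a n).2.+1).
  by move=> /tagb[t1 t2]; rewrite /emis /prio t1 t2 eqxx.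
have [bR|bR] := eqVneq b R.
  have m' : min_inf (fun n => emis R (t n) (a n)) q'.+1.
    apply: min_inf_succ mq' => n Nn; have [-> ->] := E n Nn.
    by rewrite bR eqxx; case: (R).
  by move: oq; rewrite (min_inf_unique mq m') /= negbK (negPf oq').
have m' : min_inf (fun n => emis (~~ R) (t n) (a n)) q.+1.
  apply: min_inf_succ mq => n Nn; have [-> ->] := E n Nn.
  by rewrite (negPf bR); case: (b) (R) bR => [] [].
by move: oq'; rewrite (min_inf_unique mq' m') /= negbK (negPf oq).
Qed.

(** At every node one of the two claims is for the player who does not own it and passes to both
    moves, so the owner's choice is shared. This yields a common branch. *)
Lemma runs_disjoint t rho1 rho2 R st e1 e2 u : is_tree arity t ->
  @naccepting_run _ _ aut t rho1 -> @naccepting_run _ _ aut t rho2 ->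
  t u <> None -> rho1 u = Some (R, st, e1) -> rho2 u = Some (~~ R, st, e2) ->
  False.
Proof.
move=> tt [/nrunP[_ r1] acc1] [/nrunP[_ r2] acc2] tu E1 E2.
have [| |s [_ hs]] := @step_sequence (seq nat * option bool)
  (fun us => t us.1 <> None /\ exists e1 e2,
    rho1 us.1 = Some (R, us.2, e1) /\ rho2 us.1 = Some (~~ R, us.2, e2))
  (fun us us' => exists d a, [/\ us'.1 = rcons us.1 d, t us.1 = Some a,
    us'.2 = ltag a, rho1 us'.1 = follow R us.2 a &
    rho2 us'.1 = follow (~~ R) us.2 a]) (u, st).
- move=> [v x] /= [tv [f1 [f2 [F1 F2]]]].
  case Ev: (t v) tv => [a|] // _.
  have [c1 h1] := r1 v a Ev; have [c2 h2] := r2 v a Ev.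
  have [d [d3 k1 k2]] : exists d, [/\ d < 3,
      nth None (kids (rho1 v) a c1) d = follow R x a &
      nth None (kids (rho2 v) a c2) d = follow (~~ R) x a].
    rewrite F1 F2 /=; case: (lown a) R {E1 E2 F1 F2} c1 c2 {h1 h2} => [] [] [] [] /=;
      solve [by exists 0|by exists 1].
  exists (rcons v d, ltag a); split; last by exists d, a; rewrite /= h1 // h2.
  rewrite /= h1 // h2 // k1 k2; split.
    by have [_ _ ar] := tt; apply/(ar _ _ Ev).
  by do 2!eexists.
- by split=> //; exists e1, e2.
- have /choice[d /choice[a ha]] := fun n => (hs n).2.
  have [beta hb] := @branch_of_nodes (fun n => (s n).1) d
    (fun n => let: And5 h _ _ _ _ := ha n in h).
  have bb : is_branch t beta.
    move=> n; apply: (@tree_mkseq _ _ _ (size (s 0).1 + n)) => //.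
      exact: leq_addl.
    by rewrite hb; case: (hs n) => -[].
  have /parity_winP[q1 [o1 m1]] := acc1 _ bb.
  have /parity_winP[q2 [o2 m2]] := acc2 _ bb.
  pose N := (size (s 0).1).+1.
  have m1' := (min_inf_shift _ _ N).1 m1; have m2' := (min_inf_shift _ _ N).1 m2.
  have em R' x y : (inord (emis R' x y) : 'I_K.+3) = emis R' x y :> nat.
    by rewrite inordK // ltnS; case/andP: (emis_bound R' x y).
  apply: (@emis_disjoint R (fun n => (s n).2) a q1 q2) => //.
  - by move=> n; have [] := ha n.
  - apply: (min_inf_ext (N := 0)) m1' => n _.
    by rewrite addSnnS hb; have [_ _ _ -> _] := ha n; rewrite /= em.
  - apply: (min_inf_ext (N := 0)) m2' => n _.
    by rewrite addSnnS hb; have [_ _ _ _ ->] := ha n; rewrite /= em.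
Qed.

(** Runs can first differ only in a bit [c], and different bits claim child 2 for opposite
    players. *)
Theorem aut_unambiguous : unambiguous aut.
Proof.
move=> t tt rho1 rho2 a1 a2 u.
have [/nrunP[i1 r1] _] := a1; have [/nrunP[i2 r2] _] := a2.
elim/last_ind: u => [|u d IH]; first by rewrite i1 i2.
move=> tud; have [_ cl ar] := tt.
have tu : t u <> None by apply: (cl _ [:: d]); rewrite cats1.
have Eu := IH tu; case Et: (t u) tu => [a|] // _.
have d3 : d < 3 by apply/(ar _ _ Et).
have t2 : t (rcons u 2) <> None by apply/(ar _ _ Et).
have [c1 h1] := r1 u a Et; have [c2 h2] := r2 u a Et.
rewrite h1 // h2 // Eu; have := h1 2 isT; have := h2 2 isT.
rewrite Eu; case: (rho2 u) => [[[R st] e]|] //=.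
case: ifP => // _; case: c1 {h1}; case: c2 {h2} => //= k2 k1.
  by have [] := runs_disjoint tt a1 a2 t2 k1 k2.
by have [] := runs_disjoint tt a2 a1 t2 k2 k1.
Qed.

End Automaton.

(** * Canonical runs on arena trees *)

Section ArenaTree.
Variables (K : nat) (T : Type) (lab : T -> letter K).
Variables (succ : T -> bool -> T) (cmp : T -> T) (root : T).

Definition gown (R : bool) (x : T) : bool := lown (lab x) == R.
Definition gprior (R : bool) (x : T) : nat := prio R (lab x).
Local Notation wins R := (won (gown R) succ (gprior R)).

Definition child (x : T) (d : nat) : T :=
  if d == 0 then succ x true else if d == 1 then succ x false else cmp x.
Definition node (u : seq nat) : T := foldl child root u.
Definition arena_tree (u : seq nat) : option (letter K) :=
  if all (fun d => d < 3) u then Some (lab (node u)) else None.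

Lemma arena_treeP : is_tree (@arity K) arena_tree.
Proof.
split.
- by exists [::].
- by move=> u v; rewrite /arena_tree all_cat; case: (all _ u).
- move=> u a; rewrite /arena_tree => h d; move: h; rewrite all_rcons.
  by case: (all _ u) => // _; rewrite andbT /arity; case: ltnP.
Qed.

Variable sig : bool -> T -> vec T.
Hypothesis sigP : forall R, is_sig (gown R) succ (gprior R) K.+2 (sig R).
Hypothesis tagP : forall x d b b', ltag (lab x) = Some b ->
  ltag (lab (succ x d)) = Some b' -> b = b'.
Variable ch : T -> bool.
Hypothesis chP : forall x R, lown (lab x) = R -> wins R x ->
  [/\ wins R (succ x (ch x)),
      cond true (gprior R x) (sig R (succ x (ch x))) (sig R x)
    & wins (if ch x then R else ~~ R) (cmp x)].

Definition run_step (sx : state K * T) (d : nat) : state K * T :=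
  (nth None (kids sx.1 (lab sx.2) (ch sx.2)) d, child sx.2 d).
Definition run_pair (u : seq nat) := foldl run_step (restart K true, root) u.
Definition run (u : seq nat) : state K := (run_pair u).1.

Lemma run_pair2 u : (run_pair u).2 = node u.
Proof.
elim/last_ind: u => // u d IH.
by rewrite /run_pair foldl_rcons /= -/(run_pair u) IH /node foldl_rcons.
Qed.

Lemma run_rcons u d :
  run (rcons u d) = nth None (kids (run u) (lab (node u)) (ch (node u))) d.
Proof. by rewrite /run /run_pair foldl_rcons /= -run_pair2. Qed.

Lemma node_rcons u d : node (rcons u d) = child (node u) d.
Proof. by rewrite /node foldl_rcons. Qed.

Lemma run_follow u d R t e R' t' e' : d < 3 ->
  run u = Some (R, t, e) -> wins R (node u) ->
  run (rcons u d) = Some (R', t', e') ->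
  wins R' (node (rcons u d)) /\
  if d == 2 then e' = ord0 else
    [/\ R' = R, t' = ltag (lab (node u)),
        e' = emis R t (lab (node u)) :> nat
      & cond true (gprior R (node u)) (sig R (node (rcons u d))) (sig R (node u))].
Proof.
move=> d3 ru wu; rewrite run_rcons ru node_rcons /=.
have em : (inord (emis R t (lab (node u))) : 'I_K.+3)
    = emis R t (lab (node u)) :> nat.
  by rewrite inordK // ltnS; case/andP: (emis_bound R t (lab (node u))).
case: eqP => [oR|nR].
  have [wc cc wm] := chP oR wu.
  case: (ch (node u)) wc cc wm => wc cc wm; move: d3;
    by case: d => [|[|[|]]] //= _ E; case: E => *; subst R' t' e'.
have := sig_force (sigP R) wu; rewrite /gown.
have -> : (lown (lab (node u)) == R) = false by apply/eqP.
move=> /= h; move: d3; case: d => [|[|[|]]] //= _ E; case: E => *; subst R' t' e'.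
  by have [] := h true.
by have [] := h false.
Qed.

Lemma run_wins u R t e : wins true root -> all (fun d => d < 3) u ->
  run u = Some (R, t, e) -> wins R (node u).
Proof.
move=> w0; elim/last_ind: u R t e => [|u d IH] R t e.
  by move=> _ [<- _ _].
rewrite all_rcons => /andP[d3 au] ru.
case Eu: (run u) => [[[R1 t1] e1]|].
  by have [] := run_follow d3 Eu (IH _ _ _ au Eu) ru.
by move: ru; rewrite run_rcons Eu; case: d d3 => [|[|[|]]].
Qed.

Theorem arena_tree_accepted : wins true root ->
  @naccepts _ _ (aut K) arena_tree.
Proof.
move=> w0; exists run; split.
  apply/nrunP; split=> // u a; rewrite /arena_tree; case: ifP => // _ [<-].
  by exists (ch (node u)) => d _; rewrite run_rcons.
move=> beta bb; apply/parity_winP.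
have b3 n : all (fun d => d < 3) (mkseq beta n).
  by have := bb n; rewrite /arena_tree; case: (all _ _).
have bd n : beta n < 3.
  by have := b3 n.+1; rewrite mkseqS all_rcons => /andP[].
pose s n := run (mkseq beta n); pose x n := node (mkseq beta n).
have sS n : s n.+1 = run (rcons (mkseq beta n) (beta n)) by rewrite /s mkseqS.
have xS n : x n.+1 = node (rcons (mkseq beta n) (beta n)) by rewrite /x mkseqS.
have [[n0 sn0]|allS] := pselect (exists n, s n = None).
  exists 0; split=> //; split=> // n.
  have sN m : s (n0 + m) = None.
    elim: m => [|m IH]; first by rewrite addn0.
    rewrite addnS sS run_rcons -/(s _) IH /=.
    by case: (beta _) (bd (n0 + m)) => [|[|[|]]].
  exists (n0 + n); split; first exact: leq_addl.
  by rewrite -/(s _) sN.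
have /choice[g hg] : forall n, exists g : bool * option bool * 'I_K.+3, s n = Some g.
  move=> n; case E: (s n) => [g|]; first by exists g.
  by case: allS; exists n.
pose R n := (g n).1.1; pose t n := (g n).1.2; pose e n := (g n).2.
have sE n : s n = Some (R n, t n, e n).
  by rewrite hg /R /t /e; case: (g n) => [[? ?] ?].
have fol n : if beta n == 2 then e n.+1 = ord0 else
    [/\ R n.+1 = R n, t n.+1 = ltag (lab (x n)),
        e n.+1 = emis (R n) (t n) (lab (x n)) :> nat
      & cond true (gprior (R n) (x n)) (sig (R n) (x n.+1)) (sig (R n) (x n))].
  have wn := run_wins w0 (b3 n) (sE n).
  by have := sE n.+1; rewrite sS xS => h; have [] := run_follow (bd n) (sE n) wn h.
have em q : min_inf (fun n => e n : nat) q ->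
    min_inf (fun n => nprio (aut K) (run (mkseq beta n))) q.
  by apply: (min_inf_ext (N := 0)) => n _; rewrite -/(s n) sE.
have [inf2|] := pselect (inf_often (fun n => beta n = 2)).
  (* Each turn into child 2 restarts with priority [0]. *)
  exists 0; split=> //; apply: em; split=> // n.
  have [m [nm b2]] := inf2 n; exists m.+1; split; first exact: leqW.
  by have := fol m; rewrite b2 /= => ->.
move=> /existsNP[N /forallNP nb2].
have {}fol n : N <= n -> [/\ R n.+1 = R n, t n.+1 = ltag (lab (x n)),
        e n.+1 = emis (R n) (t n) (lab (x n)) :> nat
      & cond true (gprior (R n) (x n)) (sig (R n) (x n.+1)) (sig (R n) (x n))].
  move=> Nn; have := fol n; case: eqP => // b2.
  by case: (nb2 n).
have RN n : N <= n -> R n = R N.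
  elim: n => [|n IH]; first by rewrite leqn0 => /eqP->.
  rewrite leq_eqVlt => /orP[/eqP<- //|Nn].
  by have [-> _ _ _] := fol n Nn; apply: IH.
pose a n := gprior (R N) (x n).
have aK n : 0 < a n <= K.+2 by apply: prio_bound.
have [|q [inf min]] := @min_inf_exists a K.+2 N.
  by move=> n _; case/andP: (aK n).
have mq : min_inf a q by [].
have oq : ~~ odd q.
  rewrite -[odd q]eqb_id; apply: (@cond_sound T true a (sig (R N) \o x) N) => // n Nn.
  by have [_ _ _] := fol n Nn; rewrite RN.
exists q; split=> //; apply: em.
have q1 : 1 < q.
  have [n [_ En]] := inf 0; move: oq; rewrite -En.
  by case/andP: (aK n); case: (a n) => [|[]].
have [M hM] := min_inf_eventually mq q1.
(* A state carries the emission of the letter above it, hence the shift. Beyond [M] the priorities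
   exceed [1], so tags are present and [tagP] makes neighbouring ones equal. *)
apply/(min_inf_shift _ _ 1); apply: (@min_inf_ext a _ q (maxn M N).+1) mq => n.
case: n => // n; rewrite ltnS geq_max => /andP[Mn Nn]; rewrite add1n.
have [_ tS _ _] := fol n Nn; have [_ _ -> _] := fol n.+1 (leqW Nn).
rewrite /emis tS (RN n.+1 (leqW Nn)).
suff -> : ltag (lab (x n)) = ltag (lab (x n.+1)) by rewrite eqxx.
have := hM n Mn; have := hM n.+1 (leqW Mn); rewrite /a /gprior /prio.
case E1: (ltag (lab (x n.+1))) => [b1|] // _; case E2: (ltag (lab (x n))) => [b2|] // _.
have b2n : beta n <> 2 by move=> E; case: (nb2 n).
congr Some; move: E1; rewrite xS node_rcons -/(x n) /child.
by case: (beta n) b2n (bd n) => [|[|[|]]] //= _ _ E1; apply: tagP E2 E1.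
Qed.

End ArenaTree.

(** * The arena of iterated comparisons *)

Section Terms.
Variables (K : nat) (X : Type) (blab : X -> letter K) (bsucc : X -> bool -> X).
Hypothesis K_odd : odd K.
Hypothesis blab_tag : forall x, ltag (blab x) = Some true.

(* [Cmp P v w m true] is the claim of player [P] that, in the components up to
   [m], the signature of [v] for [P] is at most that of [w], and
   [Cmp P v w m false] that it is smaller. *)
Inductive term := Base of X | Cmp of bool & term & term & nat & bool.

(** Subtracting [2] undoes the offset in [prio]: without a switch, the player named by the tag reads
    the original priority and the other its predecessor. Nested comparisons thus stay in one
    alphabet. *)
Fixpoint tlab (t : term) : letter K :=
  match t with
  | Base x => blab x
  | Cmp P v w m b =>
    let a := if b then tlab v else tlab w in
    (if b then lown a else ~~ lown a,
     if sw m (prio P a) then None else Some (if b then P else ~~ P),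
     inord (prio P a - 2))
  end.

Fixpoint tsucc (t : term) (d : bool) : term :=
  match t with
  | Base x => Base (bsucc x d)
  | Cmp P v w m b =>
    let p := prio P (if b then tlab v else tlab w) in
    Cmp P (if b then tsucc v d else v) (if b then w else tsucc w d)
      (lev m p) (b (+) sw m p)
  end.

Definition tcmp (t : term) : term :=
  Cmp (lown (tlab t)) (tsucc t true) (tsucc t false) K.+2 true.

Local Notation gown := (gown tlab).
Local Notation gprior := (gprior tlab).
Local Notation wins R := (won (gown R) tsucc (gprior R)).

Lemma tlab_tag x d b b' : ltag (tlab x) = Some b ->
  ltag (tlab (tsucc x d)) = Some b' -> b = b'.
Proof.
case: x => [x|P v w m c] /=; first by rewrite !blab_tag => -[<-] [<-].
rewrite /ltag /=; case: ifP => //= _ [<-]; rewrite addbF.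
by case: ifP => // _ [<-].
Qed.

(* A claim of [P] is, for the opponent of [P], the negation of that claim: the
   converse one with strictness exchanged. *)
Definition embed (R P : bool) (q : cpos term) : term :=
  let: (x, y, m, b) := q in
  if R == P then Cmp P x y m b else Cmp P y x m (~~ b).

Lemma embed_own R P q : gown R (embed R P q) = cown (gown P) q.
Proof.
case: q => [[[x y] m] b]; rewrite /gown /embed.
case: (eqVneq R P) => [->|] /=; rewrite /lown /=; case: b => //=.
- by case: (tlab y).1.1 P => [] [].
- by case: (tlab x).1.1 P R => [] [] [].
- by case: (tlab y).1.1 P R => [] [] [].
Qed.

Lemma embed_succ R P q d : tsucc (embed R P q) d
  = embed R P (csucc tsucc (gprior P) q d).
Proof.
case: q => [[[x y] m] b]; rewrite /embed /=.
by case: (eqVneq R P) => _; case: b => //=; rewrite negbK.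
Qed.

Lemma embed_prio R P (q : cpos term) : odd q.1.2 ->
  gprior R (embed R P q) = cprio (gprior P) q.
Proof.
case: q => [[[x y] m] b] /= om.
have E (c : bool) (v w : term) : gprior R (Cmp P v w m c) =
    let p := gprior P (if c then v else w) in
    if sw m p then 1 else if (if c then P else ~~ P) == R then p else p.-1.
  rewrite /gprior /prio /= /ltag /=.
  have -> : (if c then tlab v else tlab w) = tlab (if c then v else w) by case: c.
  rewrite -/(gprior P _); set p := gprior P _.
  rewrite -/(ltag _) -/(prio P (tlab (if c then v else w))).
  rewrite -/(gprior P (if c then v else w)) -/p.
  case: ifP => // nsw.
  have /andP[p0 pK] : 0 < p <= K.+2 by apply: prio_bound.
  (* An odd level is at least [1], so priority [1] would be a switch. *)
  have p1 : 1 < p.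
    rewrite ltn_neqAle p0 andbT eq_sym; apply/eqP => p1.
    by move: nsw; rewrite /sw p1 /=; case: (m) om.
  have -> : nat_of_ord (inord (p - 2) : 'I_K.+1) = p - 2.
    by rewrite inordK // ltnS leq_subLR add2n.
  by case: (p) p1 => [|[|r]] //= _; rewrite subSS subn1 /=.
rewrite /embed /cprio /=; case: (eqVneq R P) => RP; rewrite E.
  by case: b => /=; case: ifP => // _; rewrite RP; case: (P).
by case: b => /=; case: ifP => // _; case: (P) (R) RP => [] [].
Qed.

Variable sig : bool -> term -> vec term.
Hypothesis sigP : forall R, is_sig (gown R) tsucc (gprior R) K.+2 (sig R).

Lemma gprior_bound R x : 0 < gprior R x <= K.+2.
Proof. exact: prio_bound. Qed.

Lemma game_determined R : exists W, determined_at (gown R) tsucc (gprior R) 0 K.+3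
  (fun=> None) W.
Proof.
by apply: (@parity_determinacy _ _ _ _ K.+2) => x *; case/andP: (gprior_bound R x).
Qed.

(** Otherwise determinacy would give the opponent a measure, which [comparison_won] excludes for a
    true claim. *)
Lemma embed_won R P q :
  cinv (gown P) tsucc (gprior P) K.+2 (sig P) q -> wins R (embed R P q).
Proof.
move=> iq; have [W [comp mW _]] := game_determined R.
apply: contrapT => nw.
have nW : W.1 false (embed R P q).
  by apply/comp => W1; apply: nw; exists (W.1 true), (W.2 true).
apply: (@comparison_won _ _ _ _ _ (gprior_bound P) _ (sigP P) term
  (fun q => W.1 false (embed R P q) /\ odd q.1.2)
  (fun q => W.2 false (embed R P q)) _ _ iq); last first.
  by split=> //; case: q iq {nw nW} => [[[x y] m] b] [].
move=> p [Wp op]; have [_ /(_ erefl)] := mW false _ Wp.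
rewrite embed_own eqbF_neg; apply: force_mono => d.
rewrite embed_succ embed_prio // => -[h1 h2]; split=> //; split=> //.
move: op; case: (p) => [[[x y] m] b] /=; apply: lev_odd.
by case: b; case/andP: (gprior_bound P x) (gprior_bound P y) => + _ /andP[].
Qed.

(** The move goes to the smaller signature, the first on ties. It inherits progress from any good
    move, and the truth of the comparison decides who wins child 2. *)
Lemma canonical_choice x : exists c, forall R, lown (tlab x) = R -> wins R x ->
  [/\ wins R (tsucc x c),
      cond true (gprior R x) (sig R (tsucc x c)) (sig R x)
    & wins (if c then R else ~~ R) (tcmp x)].
Proof.
pose P := lown (tlab x).
have [wx|nw] := pselect (wins P x); last by exists true => R <- /nw.
have [b [wb cb]] : exists b, wins P (tsucc x b) /\
    cond true (gprior P x) (sig P (tsucc x b)) (sig P x).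
  by have := sig_force (sigP P) wx; rewrite /gown eqxx.
have up f g : lex K.+2 f g -> lex (gprior P x) f g.
  by apply: lex_mono; case/andP: (gprior_bound P x).
pose x0 := tsucc x true; pose x1 := tsucc x false.
have oM : odd K.+2 by rewrite /= negbK.
have [[w0 nl]|nc] := pselect (wins P x0 /\
    ~ less (gown P) tsucc (gprior P) (sig P) K.+2 (sig P x0) x1).
  exists true => R <-; split=> //; last first.
    have := @embed_won P P (x0, x1, K.+2, true); rewrite /embed eqxx; apply.
    by split.
  case: b wb cb => // wb; apply: cond_le; last exact: lex_refl.
  by apply: up; apply: contrapT => nle; apply: nl.
have w1 : wins P x1.
  case: b wb {cb} => // w0; apply: contrapT => nw1; apply: nc; split=> //.
  by case.
exists false => R <-; split=> //; last first.
  have := @embed_won (~~ P) P (x1, x0, K.+2, false); rewrite /embed.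
  have -> : (~~ P == P) = false by case: (P).
  apply; split=> // -[w0 le]; apply: nc; split=> // -[_]; exact.
case: b wb cb => // w0; apply: cond_le; last exact: lex_refl.
apply: up; apply: contrapT => nle; apply: nc; split=> // -[_ lt].
exact/nle/lexltW.
Qed.

Theorem term_tree_accepted root : wins true root ->
  @naccepts _ _ (aut K) (arena_tree tlab tsucc tcmp root).
Proof.
have /choice[ch hch] := canonical_choice.
exact: (arena_tree_accepted sigP tlab_tag hch).
Qed.

End Terms.

(** * Diagonalisation *)

Lemma inf_often_const (P : nat -> Prop) N :
  (forall n, N <= n -> P n) -> inf_often P.
Proof.
by move=> h n; exists (maxn n N); split; [apply: leq_maxl|apply/h/leq_maxr].
Qed.

Lemma min_inf_const a q v N :
  (forall n, N <= n -> a n = v) -> min_inf a q -> q = v.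
Proof.
move=> h mq; apply: min_inf_unique mq _; split; first exact: inf_often_const h.
move=> p pv /(_ N)[n [/h-> vp]]; by rewrite vp ltnn in pv.
Qed.

Section Diagonal.
Variables (k K : nat).
Hypothesis kK : k.+2 <= K.
Hypothesis K_odd : odd K.
Variable B : APTA (letter K) (@arity K).
Hypothesis Bk : forall q : aQ B, aprio B q <= k.

Local Notation tree := (seq nat -> option (letter K)).
Local Notation bpos := (option (gpos B)).

(** Player [true] reads these numbers plus [2]: [PTrue] is odd, [PFalse] even, an atom of priority
    [p] becomes [p + 3] with reversed parity, and connectives lie above all atoms. *)
Definition bnum (x : bpos) : nat :=
  if x is Some (_, phi) then
    match phi with
    | PTrue => 1
    | PFalse => 0
    | PAtom _ q => (aprio B q).+1
    | _ => k.+2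
    end
  else 0.

(* Player [true] is the opponent of Eve in the acceptance game of [B]; the
   position [None] delays the game by one step. *)
Definition blab (x : bpos) : letter K :=
  (if x is Some (_, PAnd _ _) then true else false, Some true, inord (bnum x)).

Definition bsucc (s : tree) (x : bpos) (d : bool) : bpos :=
  if x is Some (u, phi) then
    match phi with
    | PAnd f g | POr f g => Some (u, if d then f else g)
    | PAtom e q => Some (rcons u e, @delta_at _ _ B s q (rcons u e))
    | _ => x
    end
  else Some ([::], @delta_at _ _ B s (ainit B) [::]).

Local Notation term := (term bpos).
Local Notation bterm_succ s := (tsucc blab (bsucc s)).
Local Notation bterm_cmp s := (tcmp blab (bsucc s)).
Local Notation bnode s := (node (bterm_succ s) (bterm_cmp s) (Base None)).

Definition encode (s : tree) : tree :=
  arena_tree (tlab blab) (bterm_succ s) (bterm_cmp s) (Base None).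

Definition agree n (s s' : tree) := forall u, size u < n -> s u = s' u.

(** Terms at depth [n] of the encoding mention only nodes of length less than [n], thanks to the
    delay by [None]. *)
Fixpoint shorter (n : nat) (x : term) : Prop :=
  match x with
  | Base None => True
  | Base (Some (u, _)) => size u < n
  | Cmp _ v w _ _ => shorter n v /\ shorter n w
  end.

Lemma shorterS n x : shorter n x -> shorter n.+1 x.
Proof.
by elim: x => [[[u phi]|]|? v IHv w IHw ? ?] //=; [exact: leqW|case=> /IHv ? /IHw].
Qed.

Lemma tsucc_agree n s s' x d : agree n.+1 s s' -> shorter n x ->
  bterm_succ s x d = bterm_succ s' x d /\ shorter n.+1 (bterm_succ s x d).
Proof.
move=> ag; elim: x => [[[u phi]|]|P v IHv w IHw m b] /=.
- case: phi => [||e q|f g|f g] /= un; try by split=> //; apply: leqW.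
  by rewrite /delta_at ag ?size_rcons.
- by rewrite /delta_at ag.
- move=> [sv sw]; have [-> ?] := IHv sv; have [-> ?] := IHw sw.
  by case: b; split=> //; split=> //; apply: shorterS.
Qed.

Lemma bnode_agree n s s' u : agree n s s' -> size u <= n ->
  bnode s u = bnode s' u /\ shorter (size u) (bnode s u).
Proof.
move=> ag; elim/last_ind: u => [|u d IH] //; rewrite size_rcons => un.
have [E sh] := IH (ltnW un); rewrite !node_rcons -E.
have ag' : agree (size u).+1 s s' by move=> v h; apply: ag (leq_trans h un).
have h b := tsucc_agree b ag' sh.
rewrite /child; case: eqP => _; first exact: h.
case: eqP => _; first exact: h.
by rewrite /tcmp; have [-> ?] := h true; have [-> ?] := h false.
Qed.

(** Each level of the encoding depends only on strictly earlier levels of the tree read, so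
    iteration stabilises level by level and [diag] is a fixed point. *)
Lemma encode_agree n s s' : agree n s s' -> agree n.+1 (encode s) (encode s').
Proof.
by move=> ag u un; rewrite /encode /arena_tree; have [-> _] := bnode_agree ag un.
Qed.

Definition diag : tree := fun u => iter (size u).+1 encode (fun=> None) u.

Lemma diagE : encode diag = diag.
Proof.
pose it n := iter n encode (fun=> None).
have ag n j : agree n (it n) (it (n + j)).
  by elim: n => // n IH; rewrite addSn; apply: encode_agree.
have agd n : agree n diag (it n).
  by move=> u un; rewrite -(subnKC un); exact: (ag (size u).+1 _ u (ltnSn _)).
by apply/funext => u; apply: (encode_agree (agd (size u))).
Qed.

Lemma diag_tree : is_tree (@arity K) diag.
Proof. by rewrite -diagE; apply: arena_treeP. Qed.

Definition aprior (x : gpos B) : nat := gprior (tlab blab) true (Base (Some x)).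

Lemma apriorE x : aprior x = (bnum (Some x)).+2.
Proof.
rewrite /aprior /gprior /prio /= inordK // ltnS.
apply: leq_trans kK; case: x => u [||d q|f g|f g] //=.
by rewrite ltnS leqW.
Qed.

Fixpoint fsize (phi : pbf nat (aQ B)) : nat :=
  match phi with
  | PAnd f g | POr f g => (fsize f + fsize g).+1
  | _ => 0
  end.

(** A play stuck at [PTrue] or [PFalse] has constant priority [3] or [2]. Otherwise formulas shrink
    between atoms, so atoms recur and the shift by [3] turns even into odd. *)
Lemma eve_wins_odd (pl : nat -> gpos B) (d : nat -> bool) q :
  (forall n, bsucc diag (Some (pl n)) (d n) = Some (pl n.+1)) ->
  min_inf (fun n => aprior (pl n)) q -> eve_wins_play pl <-> odd q.
Proof.
move=> hpl mq.
have stuck n0 : ((pl n0).2 = PTrue \/ (pl n0).2 = PFalse) ->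
    forall n, n0 <= n -> pl n = pl n0.
  move=> st; elim=> [|n IH]; first by rewrite leqn0 => /eqP->.
  rewrite leq_eqVlt => /orP[/eqP-> //|/IH E].
  have := hpl n; rewrite E; case: (pl n0) st => u phi /=.
  by case=> ->; case.
have [[n0 Tn0]|noT] := pselect (exists n, (pl n).2 = PTrue).
  split=> _; last by left; exists n0.
  rewrite (@min_inf_const _ q 3 n0 _ mq) // => n /(stuck n0 (or_introl Tn0)) ->.
  by rewrite apriorE; case: (pl n0) Tn0 => u phi /= ->.
have [[n0 Fn0]|noF] := pselect (exists n, (pl n).2 = PFalse).
  rewrite (@min_inf_const _ q 2 n0 _ mq) /=; last first.
    move=> n /(stuck n0 (or_intror Fn0)) ->.
    by rewrite apriorE; case: (pl n0) Fn0 => u phi /= ->.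
  split=> // -[//|[p [_ [inf _]]]]; have [n [n0n]] := inf n0.
  by rewrite (stuck n0 (or_intror Fn0) n n0n) /gprio Fn0.
have live n : [\/ exists e r, (pl n).2 = PAtom e r,
    exists f g, (pl n).2 = PAnd f g | exists f g, (pl n).2 = POr f g].
  case E: ((pl n).2) => [||e r|f g|f g].
  - by case: noT; exists n.
  - by case: noF; exists n.
  - by apply: Or31; exists e, r.
  - by apply: Or32; exists f, g.
  - by apply: Or33; exists f, g.
have atoms : inf_often (fun n => exists e r, (pl n).2 = PAtom e r).
  move=> n; have [N] := ubnP (fsize (pl n).2); elim: N n => // N IH n.
  case: (live n) => [at_n _|[f [g E]]|[f [g E]]]; first by exists n.
    move=> sz; have [|m [nm am]] := IH n.+1; last by exists m; split=> //; apply: ltnW.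
    have := hpl n; move: E sz; case: (pl n) => u phi /= -> /=.
    rewrite ltnS => sz [<-] /=; apply: leq_trans sz; rewrite ltnS.
    by case: (d n); rewrite ?leq_addr ?leq_addl.
  move=> sz; have [|m [nm am]] := IH n.+1; last by exists m; split=> //; apply: ltnW.
  have := hpl n; move: E sz; case: (pl n) => u phi /= -> /=.
  rewrite ltnS => sz [<-] /=; apply: leq_trans sz; rewrite ltnS.
  by case: (d n); rewrite ?leq_addr ?leq_addl.
have atomE n p : p <= k -> (gprio (pl n) = Some p <-> aprior (pl n) = p.+3).
  move=> pk; rewrite apriorE /gprio; case: (live n) => [[e [r]]|[f [g]]|[f [g]]];
    case: (pl n) => u phi /= -> /=.
  - by split=> [[->]|[->]].
  - by split=> // -[E]; move: pk; rewrite -E ltnn.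
  - by split=> // -[E]; move: pk; rewrite -E ltnn.
have qk : q <= k.+3.
  have [M hM] := eventually_ge mq.2; have [n [Mn [e [r E]]]] := atoms M.
  apply: leq_trans (hM n Mn) _; rewrite apriorE.
  by case: (pl n) E => u phi /= ->; rewrite !ltnS.
have [n0 [_ En0]] := mq.1 0.
have q3 : 2 < q.
  rewrite -En0 apriorE; case: (live n0) => [[e [r]]|[f [g]]|[f [g]]];
    by case: (pl n0) => u phi /= ->.
case: q mq qk q3 {En0} => [|[|[|q]]] // mq; rewrite 3!ltnS => qk _.
have E p : p <= k -> (inf_often (fun n => gprio (pl n) = Some p) <->
    inf_often (fun n => aprior (pl n) = p.+3)).
  by move=> pk; split=> inf n; have [m [nm hm]] := inf n; exists m; split=> //;
    apply/(atomE m p pk).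
have pk p : inf_often (fun n => gprio (pl n) = Some p) -> p <= k.
  move=> /(_ 0)[n [_]]; rewrite /gprio; case: (pl n).2 => // e r [<-]; exact: Bk.
rewrite /= negbK; split=> [[[n Tn]|[p [op [inf min]]]]|oq].
- by case: noT; exists n.
- have -> : q = p; last by [].
  have pk' := pk p inf.
  case: (ltngtP q p) => // [qp|pq].
    by case: (min q qp); apply/E => //; exact: mq.1.
  by case: (mq.2 p.+3 pq); apply/E.
- right; exists q; split=> //; split; first by apply/E => //; exact: mq.1.
  move=> p pq inf; apply: (mq.2 p.+3) => //; apply/E => //.
  exact: leq_trans (ltnW pq) qk.
Qed.

Lemma gstepE s (sE sA : strategy B) h cur :
  Some (gstep s sE sA h cur) = bsucc s (Some cur)
    match cur.2 with
    | PAnd _ _ => sA (cur :: h)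
    | POr _ _ => sE (cur :: h)
    | _ => true
    end.
Proof.
case: cur => u [||e q|f g|f g] //=; first by case: ifP.
by case: ifP.
Qed.

Definition dflt : gpos B := ([::], PFalse).

Lemma play_histS s (sE sA : strategy B) n :
  play_hist s sE sA n.+1 = gstep s sE sA (behead (play_hist s sE sA n))
    (head dflt (play_hist s sE sA n)) :: play_hist s sE sA n.
Proof.
have : play_hist s sE sA n <> [::].
  by elim: n => //= n; case: (play_hist s sE sA n).
by rewrite /=; case: (play_hist s sE sA n).
Qed.

Local Notation wins R :=
  (won (gown (tlab blab) R) (bterm_succ diag) (gprior (tlab blab) R)).

(** By determinacy player [false] has a measure, and it yields a positional strategy for Eve. *)
Lemma diag_lost_accepted : ~ wins true (Base None) -> @aaccepts _ _ B diag.
Proof.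
move=> nw; have [W [comp mW _]] := game_determined blab (bsucc diag) true.
have W0 : W.1 false (Base None).
  by apply/comp => W1; apply: nw; exists (W.1 true), (W.2 true).
have /choice[c hc] : forall x : bpos, exists c, lown (blab x) = false ->
    W.1 false (Base x) -> W.1 false (Base (bsucc diag x c)) /\
    cond false (gprior (tlab blab) true (Base x))
      (W.2 false (Base (bsucc diag x c))) (W.2 false (Base x)).
  move=> x; have [[lx Wx]|n] := pselect (lown (blab x) = false /\ W.1 false (Base x)).
    have [_ /(_ erefl)] := mW false _ Wx; rewrite /gown /= lx /= => -[d hd].
    by exists d.
  by exists true => h1 h2; case: n.
exists (fun h => c (Some (head dflt h))) => sA.
set sE := fun h => _.
pose pl := play diag sE sA.
pose d n := match (pl n).2 with
    | PAnd _ _ => sA (pl n :: behead (play_hist diag sE sA n))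
    | POr _ _ => sE (pl n :: behead (play_hist diag sE sA n))
    | _ => true
    end.
have plS n : bsucc diag (Some (pl n)) (d n) = Some (pl n.+1).
  by rewrite -gstepE {2}/pl /play play_histS /= -/(play diag sE sA n).
have Wpl n : W.1 false (Base (Some (pl n))) -> exists e,
    bsucc diag (Some (pl n)) e = Some (pl n.+1) /\
    W.1 false (Base (Some (pl n.+1))) /\ cond false (aprior (pl n))
      (W.2 false (Base (Some (pl n.+1)))) (W.2 false (Base (Some (pl n)))).
  move=> Wn; exists (d n); split; first exact: plS.
  have [_ /(_ erefl)] := mW false _ Wn; rewrite /gown /=.
  case Eo: (lown (blab (Some (pl n)))) => /=.
    by move=> /(_ (d n)); rewrite -plS.
  move=> _; have := hc _ Eo Wn.
  suff -> : bsucc diag (Some (pl n)) (c (Some (pl n))) = Some (pl n.+1) by [].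
  rewrite -plS /d; case: (pl n) Eo => u [||e q|f g|f g] //=.
have W1 n : W.1 false (Base (Some (pl n))).
  elim: n => [|n IH]; last by have [e [_ []]] := Wpl n IH.
  have [_ /(_ erefl)] := mW false _ W0; rewrite /gown /= => -[e []] //.
have [|q [inf min]] := @min_inf_exists (fun n => aprior (pl n)) K.+2 0.
  by move=> n _; case/andP: (prio_bound true (blab (Some (pl n)))).
apply/(eve_wins_odd plS (conj inf min)).
have : ~~ bad false q.
  apply: (@cond_sound _ false (fun n => aprior (pl n))
    (fun n => W.2 false (Base (Some (pl n)))) 0) => // n _.
  by have [e [_ []]] := Wpl n (W1 n).
by rewrite /bad; case: (odd q).
Qed.

(** The bits of an accepting run choose Adam's conjuncts. Against a fixed strategy of Eve they trace
    a branch, and its acceptance means that Eve loses. *)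
Lemma diag_accepted_lost : @naccepts _ _ (aut K) diag -> ~ @aaccepts _ _ B diag.
Proof.
move=> [rho [/nrunP[r0 rS] acc]] [sE hE].
have nodeE u : all (fun d => d < 3) u -> diag u = Some (tlab blab (bnode diag u)).
  by rewrite -{1}diagE /encode /arena_tree => ->.
have /choice[c hc] : forall u, exists c, all (fun d => d < 3) u ->
    forall d, d < 3 ->
    rho (rcons u d) = nth None (kids (rho u) (tlab blab (bnode diag u)) c) d.
  move=> u; have [au|] := boolP (all (fun d => d < 3) u); last by exists true.
  by have [c hc] := rS u _ (nodeE u au); exists c.
pose bit (h : seq (gpos B)) z : bool := match (head dflt h).2 with
    | PAnd _ _ => c z
    | POr _ _ => sE (head dflt h :: behead h)
    | _ => true
    end.
pose idx (b : bool) := if b then 0 else 1.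
pose stp (hz : seq (gpos B) * seq nat) :=
  (gstep diag sE (fun=> c hz.2) (behead hz.1) (head dflt hz.1) :: hz.1,
   rcons hz.2 (idx (bit hz.1 hz.2))).
(* The branch starts at [[:: 0]] because the root is the delaying position [None]. *)
pose hz n := iter n stp ([:: ([::], @delta_at _ _ B diag (ainit B) [::])], [:: 0]).
(* With [sE] fixed only one play matters, so the length of the history determines the current
   node. *)
pose sA : strategy B := fun h => c (hz (size h).-1).2.
have size_hz n : size (hz n).1 = n.+1 by elim: n => //= n ->.
have hzE n : (hz n).1 = play_hist diag sE sA n.
  elim: n => // n IH; rewrite play_histS -IH /=; congr (_ :: _).
  have inj (x y : gpos B) : Some x = Some y -> x = y by case.
  apply: inj; rewrite !gstepE.
  have : (hz n).1 <> [::] by move=> E; have := size_hz n; rewrite E.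
  have := size_hz n; rewrite -/(hz n).
  case: (hz n).1 => // cur past [sp] _ /=.
  by rewrite /sA /= sp.
pose pl := play diag sE sA; pose z n := (hz n).2.
have plE n : pl n = head dflt (hz n).1 by rewrite hzE.
have plS n : bsucc diag (Some (pl n)) (bit (hz n).1 (z n)) = Some (pl n.+1).
  by rewrite plE [pl n.+1]plE /= gstepE.
have zS n : z n.+1 = rcons (z n) (idx (bit (hz n).1 (z n))) by [].
have z3 n : all (fun d => d < 3) (z n).
  elim: n => // n IH; rewrite zS all_rcons IH andbT /idx; by case: ifP.
have nz n : bnode diag (z n) = Base (Some (pl n)).
  elim: n => // n IH; rewrite zS node_rcons IH -(plS n).
  by rewrite /child /idx; case: (bit _ _).
have r1 : rho (z 0) = follow true None (blab None).
  by rewrite /z /= -[[:: 0]]/(rcons [::] 0) hc // r0.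
have tag1 x : ltag (blab x) = Some true by [].
have st n : exists t, rho (z n.+1) = follow true t (blab (Some (pl n))) /\
    (0 < n -> t = Some true).
  have next m t a : rho (z m) = follow true t a ->
      rho (z m.+1) = follow true (ltag a) (blab (Some (pl m))).
    move=> rm; rewrite zS hc //; last by rewrite /idx; case: ifP.
    rewrite nz rm /= /bit plE /idx.
    by case: (head dflt (hz m).1) => u [||e q|f g|f g] //=; case: ifP.
  elim: n => [|n [t [rn _]]]; first by exists (Some true); split=> //; apply: next r1.
  by exists (Some true); split=> //; apply: next rn.
have [beta hb] := branch_of_nodes zS.
have bb : is_branch diag beta.
  move=> n; apply: (@tree_mkseq _ _ _ _ (size (z 0) + n)).
  - exact: diag_tree.
  - exact: leq_addl.
  - by rewrite hb nodeE.
have /parity_winP[q [oq mq]] := acc _ bb.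
have mq' : min_inf (fun n => aprior (pl n)) q.
  have := (min_inf_shift _ _ (size (z 0)).+1).1 mq.
  apply: (min_inf_ext (N := 1)) => n n1.
  rewrite addSnnS hb; have [t [-> tn]] := st n; rewrite /= tn // inordK.
    by rewrite /emis eqxx.
  by rewrite ltnS; case/andP: (emis_bound true (Some true) (blab (Some (pl n)))).
by have /(eve_wins_odd plS mq') := hE sA; rewrite (negPf oq).
Qed.

Lemma diag_accepts :
  ~ @naccepts _ _ (aut K) diag -> @aaccepts _ _ B diag.
Proof.
move=> na; apply: diag_lost_accepted => w; apply: na.
have /choice[sig hsig] : forall R, exists sig,
    is_sig (gown (tlab blab) R) (bterm_succ diag) (gprior (tlab blab) R) K.+2 sig.
  by move=> R; apply: sig_exists => x; apply: prio_bound.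
rewrite -diagE; exact: (term_tree_accepted K_odd _ hsig w).
Qed.

End Diagonal.

Theorem theorem1 :
  forall i k : nat, i < k ->
  exists (A : finType) (ar : A -> nat) (N : NPTA A ar),
    unambiguous N /\
    ~ (exists B : APTA A ar,
         (forall q : aQ B, i <= aprio B q <= k) /\
         (forall t, is_tree ar t -> (naccepts N t <-> aaccepts B t))).
Proof.
(* Numbers up to [k.+2] must fit into the alphabet, and an odd [K] makes the top comparison level
   [K.+2] odd. *)
move=> i k _; pose K := k.+2.*2.+1.
exists (letter K), (@arity K), (aut K); split; first exact: aut_unambiguous.
move=> [B [Bik rec]].
have kK : k.+2 <= K by rewrite /K -addnn; apply: leqW; apply: leq_addr.
have K_odd : odd K by rewrite /K /= negbK odd_double.
have Bk q : aprio B q <= k by case/andP: (Bik q).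
have := rec _ (diag_tree k B).
(* In both cases the two automata disagree on [diag]. *)
have [na|nna] := pselect (naccepts (aut K) (diag k B)).
  by move=> [/(_ na) h _]; case: (diag_accepted_lost kK Bk na).
by move=> [_ h]; case: (nna (h (diag_accepts kK K_odd Bk nna))).
Qed.
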